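(* Assume that $\mathcal{G}$ is strongly connected and that the data are cooperatively sufficiently rich, i.e. there is $\alpha>0$ with $\sum_{i=1}^N\Delta_i\succeq\alpha I_n$. Let $\underline{\sigma}_{\mathbf{Q}},\overline{\sigma}_{\mathbf{Q}},\overline{\sigma}_{\mathbf{\Omega}},\underline{\sigma}_{\mathbf{\Sigma}}$ and $\chi$ be as in the context. Suppose that the restart parameters $(\omega,T_0,T)$ satisfy $\omega\in(0,1)$, $T>T_0>0$ and $$\underline{\mathbf{T}}:=\left(\frac12\frac{\overline{\sigma}_{\mathbf{Q}}}{\underline{\sigma}_{\mathbf{\Sigma}}}+T_0^2\right)^{1/2}<T<\overline{\mathbf{T}}:=\left(\frac{\underline{\sigma}_{\mathbf{Q}}(1-\omega)\underline{\sigma}_{\mathbf{\Sigma}}}{\overline{\sigma}_{\mathbf{\Omega}}^2+\chi(k_t)^2}\right)^{1/2}.$$ Then the following hold. (a) For every restart policy $\eta\in\{0,1\}^N$, the hybrid system $\mathcal{H}_c$ is input-to-state stable with respect to $|\cdot|_{\mathcal{A}_c}$ and the input $u=(\upsilon,\nu)$. (b) If $\eta_i=1$ for all $i\in\mathcal{V}$ and the flow of $\tau_c$ is $\dot\tau_c=\omega$ (in place of $\dot\tau_c\in[0,\omega]$), then there exist constants $k_1,k_2>0$ such that for every initial condition $y_0=y_c(0,0)\in(\mathbf{C}_c\cup\mathbf{D}_c)\times\mathbb{R}_{\ge0}$, every solution-input pair $(y_c,u)$ of $\mathcal{H}_c$ starting at $y_0$, and every $(t_j,j)\in\mathrm{dom}(y_c,u)$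 with $t_j:=\min\{t:(t,j)\in\mathrm{dom}(y_c,u)\}$, $$|\theta(t_j,j)-\mathbf{1}_N\otimes\theta^\star|^2\le k_1\,\mu^j\,|y_0|_{\mathcal{A}_c}^2+k_2\,|u|^2_{(t_j,j)},\qquad \mu=\mu(T):=(\underline{\mathbf{T}}/T)^2 .$$
   Context: Notation: $|\cdot|$ is the Euclidean norm, $\|\cdot\|$ the induced matrix norm, $|z|_{\mathcal A}=\inf_{s\in\mathcal A}|z-s|$; $(x,y)$ denotes concatenation; $\mathbf 1_N$ is the all-ones vector. $\gamma\in\mathcal K$ if $\gamma:\mathbb{R}_{\ge0}\to\mathbb{R}_{\ge0}$ is continuous, strictly increasing, $\gamma(0)=0$; $\gamma\in\mathcal K_\infty$ if also unbounded. $\beta\in\mathcal{KL}$ if $\beta:\mathbb{R}_{\ge0}^2\to\mathbb{R}_{\ge0}$ is nondecreasing in its first argument, nonincreasing in its second, $\lim_{r\to0^+}\beta(r,s)=0$ for each $s$ and $\lim_{s\to\infty}\beta(r,s)=0$ for each $r$. Network and data. $N\ge2$, $n\ge1$, $\mathcal V=\{1,\dots,N\}$; $\mathcal G=(\mathcal V,\mathcal E)$ is a digraph without self-arcs; $\mathcal L=[l_{ij}]\in\mathbb{R}^{N\times N}$ is a weighted Laplacian: for $i\ne j$, $l_{ij}<0$ if $(i,j)\in\mathcal E$ and $l_{ij}=0$ otherwise, and every row sums to zero. $\mathbf L=\mathcal L\otimes I_n$. $\theta^\star\in\mathbb{R}^n$ is a fixed parameter. For each $i$, $\phi_i:\mathbb{R}_{\ge0}\to\mathbb{R}^n$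 is continuous and uniformly bounded, and $t_{i,1},\dots,t_{i,\bar k_i}\ge0$ are finitely many recording times. $\Delta_i=\sum_{k=1}^{\bar k_i}\phi_i(t_{i,k})\phi_i(t_{i,k})^\top$, $\mathbf\Delta=\mathrm{diag}(\{\Delta_1,\dots,\Delta_N\})$, $\mathbf A(t)=\mathrm{diag}(\{\phi_1(t)\phi_1(t)^\top,\dots,\phi_N(t)\phi_N(t)^\top\})$ (block diagonal). Gains: $k_r>0$, $k_c>0$, $k_t\ge0$. Constants. $q\in\mathbb{R}^N$ is a unit vector with all entries positive, $q^\top\mathcal L=0$, and $\mathcal Q\mathcal L+\mathcal L^\top\mathcal Q\succeq0$ for $\mathcal Q=\mathrm{diag}(q)$ (it exists by strong connectivity). $\mathbf Q=\mathcal Q\otimes I_n$, $\overline\sigma_{\mathbf Q}=\max_iq_i$, $\underline\sigma_{\mathbf Q}=\min_iq_i$. $\mathbf\Sigma=k_r\mathbf Q\mathbf\Delta+\frac{k_c}{2}(\mathbf Q\mathbf L+\mathbf L^\top\mathbf Q)$, $\mathbf\Omega=\frac{k_c}{2}(\mathbf Q\mathbf L-\mathbf L^\top\mathbf Q)$; $\overline\sigma_{\mathbf\Omega}$ is the largest singular value of $\mathbf\Omega$; $\underline\sigma_{\mathbf\Sigma}>0$ is a constant with $\mathbf\Sigma\succeq\underline\sigma_{\mathbf\Sigma}I_{Nn}$ (it exists under the stated assumptions). $\chi\in\mathcal K_\infty$ is a function such that $[\mathbf\Omega+k\mathbf Q\mathbf A(t)][\mathbf\Omega+k\mathbf Q\mathbf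 A(t)]^\top\preceq(\overline\sigma_{\mathbf\Omega}^2+\chi(k)^2)I_{Nn}$ for all $k\ge0$, $t\ge0$ (it exists). If $\overline\sigma_{\mathbf\Omega}^2+\chi(k_t)^2=0$, then $\overline{\mathbf T}=+\infty$. Hybrid systems. A hybrid system with state $x$ and input $u$ has flows $\dot x\in F(x,u)$ when $x$ is in the flow set, and jumps $x^+\in G(x)$ when $x$ is in the jump set. Solution pairs $(x,u)$ are defined on hybrid time domains $\mathrm{dom}(x)=\mathrm{dom}(u)\subset\mathbb{R}_{\ge0}\times\mathbb{Z}_{\ge0}$ in the standard sense of Goebel–Sanfelice–Teel / Cai–Teel; $u(\cdot,j)$ is locally essentially bounded and measurable for each $j$. $|u|_{(t,j)}=\operatorname{ess\,sup}_{(0,0)\preceq(\tilde t,\tilde j)\preceq(t,j)}|u(\tilde t,\tilde j)|$. The system is input-to-state stable (ISS) with respect to $|\cdot|_{\mathcal A}$ if there are $\beta\in\mathcal{KL}$, $\gamma\in\mathcal K$ such that every maximal solution pair satisfies $|x(t,j)|_{\mathcal A}\le\beta(|x(0,0)|_{\mathcal A},t+j)+\gamma(|u|_{(t,j)})$ for all $(t,j)\in\mathrm{dom}(x)$. The system $\mathcal H_c$. State $y_c=(\theta,p,\tau_c,s)\in\mathbb{R}^{Nn}\times\mathbb{R}^{Nn}\times\mathbb{R}\times\mathbb{R}$, with $\theta=(\theta_1,\dots,\theta_N)$, $p=(p_1,\dots,p_N)$, $\theta_i,p_i\in\mathbb{R}^n$; input $u=(\upsilon,\nu)$ with $\upsilon=(\upsilon_1,\dots,\upsilon_N)\in\mathbb{R}^N$,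 $\nu=(\nu_1,\dots,\nu_N)$, $\nu_i=(\nu_{i,1},\dots,\nu_{i,\bar k_i})\in\mathbb{R}^{\bar k_i}$. Flow: when $(\theta,p,\tau_c)\in\mathbf C_c:=\mathbb{R}^{nN}\times\mathbb{R}^{nN}\times[T_0,T]$ and $s\ge0$, $$\dot\theta=\tfrac{2}{\tau_c}(p-\theta),\quad \dot p=-2\tau_c\big(k_t\mathbf\Psi(\theta,s,\upsilon)+k_r\mathbf\Phi(\theta,\nu)+k_c\mathbf L\theta\big),\quad \dot\tau_c\in[0,\omega],\quad \dot s=1,$$ where $\mathbf\Psi=(\Psi_1,\dots,\Psi_N)$, $\Psi_i(\theta_i,s,\upsilon_i)=\phi_i(s)\big(\phi_i(s)^\top\theta_i-\phi_i(s)^\top\theta^\star-\upsilon_i\big)$, and $\mathbf\Phi=(\Phi_1,\dots,\Phi_N)$, $\Phi_i(\theta_i,\nu_i)=\sum_{k=1}^{\bar k_i}\phi_i(t_{i,k})\big(\phi_i(t_{i,k})^\top\theta_i-\phi_i(t_{i,k})^\top\theta^\star-\nu_{i,k}\big)$. Jump: when $(\theta,p,\tau_c)\in\mathbf D_c:=\mathbb{R}^{nN}\times\mathbb{R}^{nN}\times\{T\}$ and $s\ge0$, $$\theta^+=\theta,\quad p^+=p+\mathbf R_\eta(\theta-p),\quad \tau_c^+=T_0,\quad s^+=s,\qquad \mathbf R_\eta=\mathrm{diag}(\eta)\otimes I_n,\ \eta\in\{0,1\}^N .$$ Finally $\mathcal A_c=\{\mathbf 1_N\otimes\theta^\star\}\times\{\mathbf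 1_N\otimes\theta^\star\}\times[T_0,T]\times\mathbb{R}_{\ge0}$. *)

(* Defs.v *)
From HB Require Import structures.
From mathcomp Require Import all_boot all_order all_algebra.
From mathcomp Require Import mxtens.
From mathcomp Require Import all_classical all_reals all_analysis.
From mathcomp Require Import ess_sup_inf.

Set Implicit Arguments.
Unset Strict Implicit.
Unset Printing Implicit Defensive.

Import Order.TTheory GRing.Theory Num.Theory.
Import numFieldNormedType.Exports.

Local Open Scope classical_set_scope.
Local Open Scope ring_scope.

Section Euclidean.
Variable R : realType.

(* The library norm on 'cV[R]_m is the sup norm, hence this definition. *)
Definition enorm m (x : 'cV[R]_m) : R := Num.sqrt (\sum_i x i 0 ^+ 2).

Definition setdist m (A : set 'cV[R]_m) (z : 'cV[R]_m) : R :=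
  inf [set enorm (z - a) | a in A].

Definition psd m (M : 'M[R]_m) : Prop :=
  M^T = M /\ forall x : 'cV[R]_m, 0 <= (x^T *m M *m x) 0 0.

Definition loewner_le m (A B : 'M[R]_m) : Prop := psd (B - A).

Definition singular_values m (M : 'M[R]_m) : set R :=
  [set Num.sqrt a | a in [set a | eigenvalue (M^T *m M) a]].

(* The set of singular values is finite and, for m > 0, nonempty. *)
Definition max_singular_value m (M : 'M[R]_m) : R := sup (singular_values M).

End Euclidean.

Section ComparisonFunctions.
Variable R : realType.

(* Functions on [0, +oo[ are total functions on R whose values at negative
   arguments are irrelevant. *)
Definition classK (g : R -> R) : Prop :=
  [/\ {within `[0, +oo[, continuous g},
      forall r s, 0 <= r -> r < s -> g r < g s
    & g 0 = 0].

Definition classKoo (g : R -> R) : Prop :=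
  classK g /\ forall M : R, exists2 r, 0 <= r & M < g r.

Definition classKL (b : R -> R -> R) : Prop :=
  [/\ forall r s, 0 <= r -> 0 <= s -> 0 <= b r s,
      forall r r' s, 0 <= r -> r <= r' -> 0 <= s -> b r s <= b r' s,
      forall r s s', 0 <= r -> 0 <= s -> s <= s' -> b r s' <= b r s,
      forall s, 0 <= s -> b r s @[r --> 0^'+] --> 0
    & forall r, 0 <= r -> b r s @[s --> +oo] --> 0].

End ComparisonFunctions.

Section HybridSystems.
Variable R : realType.

Local Notation mu := (@lebesgue_measure R).

Definition compact_hybrid_time_domain (E : set (R * nat)) : Prop :=
  exists (J : nat) (t : nat -> R),
    [/\ t 0%N = 0, forall j, (j < J)%N -> t j <= t j.+1
      & E = [set z | (z.2 < J)%N /\ t z.2 <= z.1 <= t z.2.+1]].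

Definition hybrid_time_domain (E : set (R * nat)) : Prop :=
  E `<=` [set z | 0 <= z.1] /\
  forall T J, E (T, J) ->
    compact_hybrid_time_domain (E `&` [set z | z.1 <= T /\ (z.2 <= J)%N]).

Definition htd_slice (E : set (R * nat)) (j : nat) : set R :=
  [set t | E (t, j)].

Definition absolutely_continuous_on m (a b : R) (f : R -> 'cV[R]_m) : Prop :=
  forall e : R, 0 < e -> exists2 d : R, 0 < d &
    forall (k : nat) (l r : 'I_k -> R),
      (forall i, [/\ a <= l i, l i <= r i & r i <= b]) ->
      (forall i i', i != i' -> r i <= l i' \/ r i' <= l i) ->
      \sum_i (r i - l i) < d ->
      \sum_i enorm (f (r i) - f (l i)) < e.

Definition locally_absolutely_continuous_on m (I : set R) (f : R -> 'cV[R]_m) :=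
  forall a b, a <= b -> `[a, b] `<=` I -> absolutely_continuous_on a b f.

(* Measurability with respect to the completed (Lebesgue) sigma-algebra. *)
Definition lebesgue_measurable_fun (I : set R) (f : R -> R) : Prop :=
  measurable_fun
    (I : set (caratheodory_type ((wlength (@idfun R))^*)%mu)) f.

Definition locally_ess_bounded_on m (I : set R) (f : R -> 'cV[R]_m) : Prop :=
  forall a b, a <= b -> `[a, b] `<=` I ->
    exists M : R, \forall t \ae mu, t \in `[a, b] -> enorm (f t) <= M.

(* Hybrid signals are total functions; only their values on the hybrid time
   domain E are meaningful. *)
Definition hybrid_arc m (E : set (R * nat)) (x : R -> nat -> 'cV[R]_m) : Prop :=
  hybrid_time_domain E /\
  forall j, locally_absolutely_continuous_on (htd_slice E j) (x ^~ j).

Definition hybrid_input p (E : set (R * nat)) (u : R -> nat -> 'cV[R]_p) : Prop :=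
  [/\ hybrid_time_domain E,
      forall j i, lebesgue_measurable_fun (htd_slice E j) (fun t => u t j i 0)
    & forall j, locally_ess_bounded_on (htd_slice E j) (u ^~ j)].

Record hybrid_system (m p : nat) := HybridSystem {
  flow_set : set 'cV[R]_m;
  flow_map : 'cV[R]_m -> 'cV[R]_p -> set 'cV[R]_m;
  jump_set : set 'cV[R]_m;
  jump_map : 'cV[R]_m -> set 'cV[R]_m }.

Record solution_pair m p (H : hybrid_system m p) (E : set (R * nat))
    (x : R -> nat -> 'cV[R]_m) (u : R -> nat -> 'cV[R]_p) : Prop :=
  SolutionPair {
  sol_arc : hybrid_arc E x;
  sol_input : hybrid_input E u;
  sol_start : E (0, 0%N);
  sol_init : (flow_set H `|` jump_set H) (x 0 0%N);
  sol_flow_set : forall j t, (htd_slice E j)° t -> flow_set H (x t j);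
  sol_flow : forall j, \forall t \ae mu, (htd_slice E j)° t ->
    exists2 v, flow_map H (x t j) (u t j) v & is_derive t (1 : R) (x ^~ j) v;
  sol_jump : forall t j, E (t, j) -> E (t, j.+1) ->
    jump_set H (x t j) /\ jump_map H (x t j) (x t j.+1) }.

Definition maximal_solution_pair m p (H : hybrid_system m p)
    (E : set (R * nat)) (x : R -> nat -> 'cV[R]_m) (u : R -> nat -> 'cV[R]_p) :=
  solution_pair H E x u /\
  forall E' x' u', solution_pair H E' x' u' -> E `<=` E' ->
    (forall t j, E (t, j) -> x' t j = x t j /\ u' t j = u t j) -> E' = E.

(* Essential supremum of |u| over the part of E below (t, j), for the product
   of Lebesgue and counting measure, with value 0 on null sets. It is finite
   when u satisfies hybrid_input E and (t, j) is in E, so that fine does not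
   collapse it. *)
Definition input_norm p (E : set (R * nat)) (u : R -> nat -> 'cV[R]_p)
    (t : R) (j : nat) : R :=
  fine (\big[maxe/0%E]_(k < j.+1)
    ess_sup mu (fun s => if `[< E (s, nat_of_ord k) /\ s <= t >]
                         then (enorm (u s k))%:E else 0%E)).

Definition ISS m p (H : hybrid_system m p) (A : set 'cV[R]_m) : Prop :=
  exists (beta : R -> R -> R) (gamma : R -> R),
    [/\ classKL beta, classK gamma &
      forall E x u, maximal_solution_pair H E x u ->
        forall t j, E (t, j) ->
          setdist A (x t j) <=
            beta (setdist A (x 0 0%N)) (t + j%:R) + gamma (input_norm E u t j)].

End HybridSystems.

Section Network.
Variables (R : realType) (N n : nat).

Definition strongly_connected (E : rel 'I_N) : Prop :=
  forall i j, connect E i j.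

Definition weighted_laplacian (E : rel 'I_N) (L : 'M[R]_N) : Prop :=
  [/\ forall i j, i != j -> E i j -> L i j < 0,
      forall i j, i != j -> ~~ E i j -> L i j = 0
    & forall i, \sum_j L i j = 0].

Definition block (i : 'I_N) (x : 'cV[R]_(N * n)) : 'cV[R]_n :=
  \col_j x (mxtens_index (i, j)) 0.

Definition stack (v : 'I_N -> 'cV[R]_n) : 'cV[R]_(N * n) :=
  \col_k v (mxtens_unindex k).1 (mxtens_unindex k).2 0.

Definition block_diag (B : 'I_N -> 'M[R]_n) : 'M[R]_(N * n) :=
  \sum_i delta_mx i i *t B i.

Definition kronI (M : 'M[R]_N) : 'M[R]_(N * n) := M *t (1%:M : 'M[R]_n).

Definition consensus (theta : 'cV[R]_n) : 'cV[R]_(N * n) :=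
  (const_mx 1 : 'cV[R]_N) *t theta.

Section Data.
Variables (phi : 'I_N -> R -> 'cV[R]_n).
Variables (kbar : 'I_N -> nat) (trec : forall i, 'I_(kbar i) -> R).

Definition Delta (i : 'I_N) : 'M[R]_n :=
  \sum_(k < kbar i) phi i (trec k) *m (phi i (trec k))^T.

Definition bDelta : 'M[R]_(N * n) := block_diag Delta.

Definition bA (t : R) : 'M[R]_(N * n) :=
  block_diag (fun i => phi i t *m (phi i t)^T).

Definition cooperatively_sufficiently_rich : Prop :=
  exists2 alpha : R, 0 < alpha & loewner_le alpha%:M (\sum_i Delta i).

Definition qmax (q : 'cV[R]_N) : R := sup (range (fun i => q i 0)).
Definition qmin (q : 'cV[R]_N) : R := inf (range (fun i => q i 0)).

Definition Qmx (q : 'cV[R]_N) : 'M[R]_N := diag_mx q^T.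
Definition bQ (q : 'cV[R]_N) : 'M[R]_(N * n) := kronI (Qmx q).

Variables (L : 'M[R]_N) (kr kc : R).

Definition bSigma (q : 'cV[R]_N) : 'M[R]_(N * n) :=
  kr *: (bQ q *m bDelta) + (kc / 2) *: (bQ q *m kronI L + (kronI L)^T *m bQ q).

Definition bOmega (q : 'cV[R]_N) : 'M[R]_(N * n) :=
  (kc / 2) *: (bQ q *m kronI L - (kronI L)^T *m bQ q).

Definition chi_bound (q : 'cV[R]_N) (chi : R -> R) : Prop :=
  forall k t : R, 0 <= k -> 0 <= t ->
    let M := bOmega q + k *: (bQ q *m bA t) in
    loewner_le (M *m M^T)
      ((max_singular_value (bOmega q) ^+ 2 + chi k ^+ 2)%:M).

Definition Tlow (q : 'cV[R]_N) (sigS T0 : R) : R :=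
  Num.sqrt (2^-1 * (qmax q / sigS) + T0 ^+ 2).

Definition Tup (q : 'cV[R]_N) (sigS : R) (chi : R -> R) (kt omega : R) : \bar R :=
  let den := max_singular_value (bOmega q) ^+ 2 + chi kt ^+ 2 in
  if den == 0 then +oo%E
  else (Num.sqrt (qmin q * (1 - omega) * sigS / den))%:E.

(* The state y = (theta, p, tau, s) and the input u = (upsilon, nu), with
   nu = (nu_1, ..., nu_N), are concatenated column vectors. *)
Definition state_dim : nat := N * n + (N * n + (1 + 1)).
Definition input_dim : nat := N + \sum_i kbar i.

Definition mkstate (theta p : 'cV[R]_(N * n)) (tau s : R) : 'cV[R]_state_dim :=
  col_mx theta (col_mx p (col_mx (tau%:M : 'cV[R]_1) (s%:M : 'cV[R]_1))).

Definition st_theta (y : 'cV[R]_state_dim) : 'cV[R]_(N * n) := usubmx y.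
Definition st_p (y : 'cV[R]_state_dim) : 'cV[R]_(N * n) := usubmx (dsubmx y).
Definition st_tau (y : 'cV[R]_state_dim) : R := (usubmx (dsubmx (dsubmx y))) 0 0.
Definition st_s (y : 'cV[R]_state_dim) : R := (dsubmx (dsubmx (dsubmx y))) 0 0.

Definition in_upsilon (u : 'cV[R]_input_dim) (i : 'I_N) : R := usubmx u i 0.
Definition in_nu (u : 'cV[R]_input_dim) (i : 'I_N) (k : 'I_(kbar i)) : R :=
  submxcol (dsubmx u) i k 0.

Variables (thetastar : 'cV[R]_n) (kt : R).

Definition bPsi (theta : 'cV[R]_(N * n)) (s : R) (u : 'cV[R]_input_dim) :=
  stack (fun i => phi i s *m
    ((phi i s)^T *m block i theta - (phi i s)^T *m thetastar
     - (in_upsilon u i)%:M)).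

Definition bPhi (theta : 'cV[R]_(N * n)) (u : 'cV[R]_input_dim) :=
  stack (fun i => \sum_(k < kbar i) phi i (trec k) *m
    ((phi i (trec k))^T *m block i theta - (phi i (trec k))^T *m thetastar
     - (in_nu u k)%:M)).

Definition restart_mx (eta : 'I_N -> bool) : 'M[R]_(N * n) :=
  kronI (diag_mx (\row_i (eta i)%:R)).

Variables (T0 T : R).

(* The set rates collects the admissible values of the derivative of tau:
   the interval [0, omega], or the singleton omega. *)
Definition Hc (eta : 'I_N -> bool) (rates : set R) :
    hybrid_system R state_dim input_dim :=
  {| flow_set := [set y | T0 <= st_tau y <= T /\ 0 <= st_s y];
     flow_map := fun y u =>
       [set mkstate
          ((2 / st_tau y) *: (st_p y - st_theta y))
          (- (2 * st_tau y) *: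
             (kt *: bPsi (st_theta y) (st_s y) u
              + kr *: bPhi (st_theta y) u
              + kc *: (kronI L *m st_theta y)))
          r 1 | r in rates];
     jump_set := [set y | st_tau y = T /\ 0 <= st_s y];
     jump_map := fun y =>
       [set mkstate (st_theta y)
          (st_p y + restart_mx eta *m (st_theta y - st_p y)) T0 (st_s y)] |}.

Definition Ac : set 'cV[R]_state_dim :=
  [set y | [/\ st_theta y = consensus thetastar, st_p y = consensus thetastar,
               T0 <= st_tau y <= T & 0 <= st_s y]].

End Data.

End Network.

(* Main.v *)
(* Put x = theta - 1 (x) theta*, z = p - 1 (x) theta* and
     V = 1/4 (z-x)' Q (z-x) + 1/4 z' Q z + tau^2/2 x' Sigma x.
   Along flows the cross terms between z - x and Sigma x cancel, and Young's
   inequality with T < Tup absorbs those with Omega + kt Q A, so that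
   V' <= - lam V + K |u|^2. The condition T > Tlow makes V nonincreasing at
   jumps for every eta, and contracts it by mu when every agent restarts. As
   solutions are only absolutely continuous, V' <= - lam V + K |u|^2 is
   integrated through the fact that an absolutely continuous function with
   nonpositive derivative almost everywhere is nonincreasing. *)
Require Import Defs.
From HB Require Import structures.
From mathcomp Require Import all_boot all_order all_algebra.
From mathcomp Require Import mxtens.
From mathcomp Require Import all_classical all_reals all_analysis.
From mathcomp Require Import ess_sup_inf.
From mathcomp Require Import ring lra.

Set Implicit Arguments.
Unset Strict Implicit.
Unset Printing Implicit Defensive.

Import Order.TTheory GRing.Theory Num.Theory.
Import numFieldNormedType.Exports.

Local Open Scope classical_set_scope.
Local Open Scope ring_scope.

(** The two bounds on T are budgets. Once the cross terms with Sigma are gone, put w = z - x and M =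
    Omega + kt Q A. The terms qmin/tau |w|^2 and tau (1 - omega) sigS |x|^2 must dominate 2 tau w^T
    M x. A Young weight k does this if it lies between T^2 D / qmin and (1 - omega) sigS, where D I
    bounds M M^T; that interval is nonempty exactly when T < Tup. At a jump the Q-terms may grow by
    qmax/4 |x|^2, while the reset of tau frees (T^2 - T0^2)/2 x^T Sigma x; T > Tlow expresses this
    balance. For a general policy jumps give no strict decrease, so in (a) all decay comes from flow
    time and the jumps have to be counted; in (b) the decay in j comes from the jumps alone. One
    induction serves both. It propagates V - (K/lam) U^2, with U the input norm frozen at the final
    hybrid time: this level attracts along flows and is not exceeded through jumps, so input
    contributions do not pile up over the jumps. *)

Section ScalarAbsoluteContinuity.
Variable R : realType.
Implicit Types (a b : R) (f g : R -> R).

(** * Absolutely continuous real functions *)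

Definition disjoint_subintervals a b k (l r : 'I_k -> R) : Prop :=
  (forall i, [/\ a <= l i, l i <= r i & r i <= b]) /\
  (forall i i', i != i' -> r i <= l i' \/ r i' <= l i).

(** Real-valued counterpart of [absolutely_continuous_on]. Trajectories are handled by coordinates,
    and V, a polynomial in them, is reached through closure under sums and products. *)
Definition ac a b f : Prop :=
  forall e : R, 0 < e -> exists2 d : R, 0 < d &
    forall k (l r : 'I_k -> R), disjoint_subintervals a b l r ->
      \sum_i (r i - l i) < d -> \sum_i `|f (r i) - f (l i)| < e.

Lemma ac_small_increment a b f (e : R) : ac a b f -> 0 < e ->
  exists2 d, 0 < d & forall s t, a <= s -> s <= t -> t <= b -> t - s < d ->
    `|f t - f s| < e.
Proof.
move=> acf e0; have [d d0 H] := acf e e0; exists d => // s t as_ st tb std.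
have := H 1%N (fun=> s) (fun=> t); rewrite !big_ord1; apply => //.
by split => [i|i i']; [split|rewrite !ord1].
Qed.

Lemma ac_within_continuous a b f :
  ac a b f -> {within `[a, b], continuous f}.
Proof.
move=> acf; apply/subspace_continuousP => x /=; rewrite in_itv/= => /andP[ax xb].
apply/cvgrPdist_lt => e e0.
have [d d0 H] := ac_small_increment acf e0.
rewrite near_withinE; near=> t => /=; rewrite in_itv/= => /andP[at_ tb].
have xtd : `|x - t| < d by near: t; exact: cvgr_dist_lt.
have [tx|/ltW xt] := leP t x.
  by apply: H => //; apply: le_lt_trans xtd; rewrite ler_norm.
by rewrite distrC; apply: H => //; apply: le_lt_trans xtd; rewrite distrC ler_norm.
Unshelve. all: by end_near. Qed.

Lemma ac_bounded a b f : a <= b -> ac a b f ->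
  exists2 B, 0 < B & forall t, a <= t -> t <= b -> `|f t| <= B.
Proof.
move=> ab acf.
have fc := ac_within_continuous acf.
have [c1 _ H1] := EVT_max ab fc.
have [c2 _ H2] := EVT_min ab fc.
exists (`|f c1| + `|f c2| + 1) => [|t at_ tb]; first by rewrite ltr_wpDl ?addr_ge0.
have tab : t \in `[a, b] by rewrite in_itv/= at_ tb.
have := H1 _ tab; have := H2 _ tab => h2 h1.
have := ler_norm (f c1); have := ler_norm (- f c2); rewrite normrN => h3 h4.
have := normr_ge0 (f c1); have := normr_ge0 (f c2) => h5 h6.
by rewrite ler_norml; apply/andP; split; lra.
Qed.

Lemma ac_lipschitz a b f (K : R) :
  (forall s t, a <= s -> s <= t -> t <= b -> `|f t - f s| <= K * (t - s)) ->
  ac a b f.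
Proof.
(* [K] may be zero or negative, and [e] is divided by the constant. *)
move=> fK e e0; pose K' := `|K| + 1.
have K'0 : 0 < K' by rewrite /K'; have := normr_ge0 K; lra.
exists (e / K') => [|k l r [H1 _] H]; first by rewrite divr_gt0.
apply: (@le_lt_trans _ _ (\sum_i K' * (r i - l i))); last first.
  by rewrite -mulr_sumr mulrC -ltr_pdivlMr.
apply: ler_sum => i _; have [al lr rb] := H1 i.
apply: le_trans (fK _ _ al lr rb) _; rewrite ler_wpM2r ?subr_ge0//.
by rewrite /K' (le_trans (ler_norm K))// lerDl.
Qed.

Lemma ac_cst a b (c : R) : ac a b (fun=> c).
Proof. by apply: (@ac_lipschitz _ _ _ 0) => s t *; rewrite subrr normr0 mul0r. Qed.

Lemma acD a b f g : ac a b f -> ac a b g -> ac a b (fun t => f t + g t).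
Proof.
move=> acf acg e e0; have e20 : 0 < e / 2 by rewrite divr_gt0.
have [d1 d10 H1] := acf _ e20; have [d2 d20 H2] := acg _ e20.
exists (Num.min d1 d2) => [|k l r H]; first by rewrite lt_min d10 d20.
rewrite lt_min => /andP[/(H1 _ _ _ H) h1 /(H2 _ _ _ H) h2].
rewrite [e]splitr; apply: le_lt_trans (ltrD h1 h2).
rewrite -big_split/=; apply: ler_sum => i _.
by rewrite opprD addrACA ler_normD.
Qed.

Lemma acN a b f : ac a b f -> ac a b (fun t => - f t).
Proof.
move=> acf e e0; have [d d0 H] := acf e e0; exists d => // k l r Hlr lrd.
apply: le_lt_trans (H k l r Hlr lrd); apply: ler_sum => i _.
by rewrite -opprD normrN.
Qed.

Lemma acM a b f g : a <= b -> ac a b f -> ac a b g ->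
  ac a b (fun t => f t * g t).
Proof.
move=> ab acf acg e e0.
have [A A0 HA] := ac_bounded ab acf; have [B B0 HB] := ac_bounded ab acg.
have eA0 : 0 < e / (2 * A) by rewrite divr_gt0 ?mulr_gt0.
have eB0 : 0 < e / (2 * B) by rewrite divr_gt0 ?mulr_gt0.
have [d1 d10 H1] := acf _ eB0; have [d2 d20 H2] := acg _ eA0.
exists (Num.min d1 d2) => [|k l r H]; first by rewrite lt_min d10 d20.
rewrite lt_min => /andP[/(H1 _ _ _ H) h1 /(H2 _ _ _ H) h2].
rewrite (_ : e = B * (e / (2 * B)) + A * (e / (2 * A))); last first.
  by field; rewrite !gt_eqF.
apply: (@le_lt_trans _ _ (B * (\sum_i `|f (r i) - f (l i)|)
    + A * \sum_i `|g (r i) - g (l i)|)); last first.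
  by rewrite ltrD// ltr_pM2l.
rewrite !mulr_sumr -big_split/=; apply: ler_sum => i _.
have [al lr rb] := H.1 i.
have -> : f (r i) * g (r i) - f (l i) * g (l i)
  = g (r i) * (f (r i) - f (l i)) + f (l i) * (g (r i) - g (l i)) by ring.
rewrite (le_trans (ler_normD _ _))// !normrM lerD// ler_wpM2r//.
  by apply: HB => //; exact: le_trans lr.
by apply: HA => //; exact: le_trans rb.
Qed.

Lemma ac_sum a b (I : Type) (s : seq I) (F : I -> R -> R) :
  (forall i, ac a b (F i)) -> ac a b (fun t => \sum_(i <- s) F i t).
Proof.
move=> H; elim: s => [|i s IH].
  by under eq_fun do rewrite big_nil; exact: ac_cst.
by under eq_fun do rewrite big_cons; exact: (acD (H i) IH).
Qed.

Lemma acZ a b (c : R) f : a <= b -> ac a b f -> ac a b (fun t => c * f t).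
Proof. by move=> ab ?; apply: acM => //; exact: ac_cst. Qed.

Lemma ac_id a b : ac a b id.
Proof.
apply: (@ac_lipschitz _ _ _ 1) => s t _ st _.
by rewrite mul1r ger0_norm// subr_ge0.
Qed.

(** Lipschitz on the interval: the tangent inequality [1 + x <= expR x] at x = v - u gives expR u -
    expR v <= expR u (u - v), without a mean value theorem. It serves the integrating factor of
    [ac_decay]. *)
Lemma ac_expR a b (c : R) : ac a b (fun t => expR (c * t)).
Proof.
pose B := expR (`|c| * (`|a| + `|b|)).
have eB s : a <= s -> s <= b -> expR (c * s) <= B.
  move=> as_ sb; rewrite ler_expR (le_trans (ler_norm _))// normrM ler_wpM2l//.
  have := ler_norm b; have := ler_norm (- a); rewrite normrN => h1 h2.
  have := normr_ge0 a; have := normr_ge0 b => h3 h4.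
  by rewrite ler_norml; apply/andP; split; lra.
have le1 (u v : R) : expR u - expR v <= expR u * (u - v).
  have -> : expR v = expR u * expR (v - u) by rewrite -expRD subrKC.
  rewrite -[X in X - _]mulr1 -mulrBr ler_pM2l ?expR_gt0//.
  by have := expR_ge1Dx (v - u); lra.
apply: (@ac_lipschitz _ _ _ (B * `|c|)) => s t as_ st tb.
have bnd u v : a <= u -> u <= b ->
    expR (c * u) - expR (c * v) <= B * `|c| * `|u - v|.
  move=> au ub; apply: le_trans (le1 _ _) _.
  rewrite -mulrBr -mulrA -normrM; apply: le_trans (ler_norm _) _.
  by rewrite [leLHS]normrM ler_wpM2r// ger0_norm ?expR_ge0// eB.
have sb := le_trans st tb; have at_ := le_trans as_ st.
have := bnd s t as_ sb; have := bnd t s at_ tb.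
rewrite (distrC s) [`|t - s|]ger0_norm ?subr_ge0// => h1 h2.
by rewrite ler_norml h1 andbT lerNl opprB.
Qed.

(** Solutions satisfy the flow constraints only in the interior of a time slice; continuity carries
    them to the right end, where a jump may occur. *)
Lemma ac_le_right a b f (c : R) : a < b -> ac a b f ->
  (forall t, a < t -> t < b -> f t <= c) -> f b <= c.
Proof.
move=> ab acf H; rewrite leNgt; apply/negP => cfb.
have e0 : 0 < f b - c by rewrite subr_gt0.
have [d d0 Hd] := ac_small_increment acf e0.
(* A point strictly inside the interval and at distance at most d / 2 from b. *)
pose t := Num.max ((a + b) / 2) (b - d / 2).
have [at_ tb] : a < t /\ t < b.
  rewrite /t lt_max gt_max.
  by split; [apply/orP; left|apply/andP; split]; lra.
have : `|f b - f t| < f b - c.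
  apply: Hd => //; rewrite ?ltW//.
  suff : b - d < t by lra.
  by rewrite /t lt_max; apply/orP; right; lra.
by have := ler_norm (f b - f t); have := H t at_ tb; lra.
Qed.

End ScalarAbsoluteContinuity.

(** * Monotonicity from the sign of an almost everywhere derivative *)

Section AlmostEverywhereMonotone.
Variable R : realType.
Local Notation mu := (@lebesgue_measure R).
Implicit Types (a b : R) (f g : R -> R).

Lemma is_derive_increment f (x d e : R) : is_derive x 1 f d -> 0 < e ->
  exists2 eta, 0 < eta &
    forall h, `|h| < eta -> `|f (x + h) - f x - d * h| <= e * `|h|.
Proof.
move=> [dx dfx] e0.
have : (fun h => h^-1 *: (f (h *: (1 : R) + x) - f x)) @ 0^' --> d.
  by rewrite -dfx; exact: dx.
move=> /cvgrPdist_le /(_ e e0) [eta/= eta0 H].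
exists eta => // h heta.
have [->|h0] := eqVneq h 0.
  by rewrite addr0 subrr mulr0 subrr !normr0 mulr0.
have := H h; rewrite /= sub0r normrN => /(_ heta h0).
move=> H1; rewrite -ler_pdivrMr ?normr_gt0//; apply: le_trans H1.
rewrite -normfV -normrM distrC /GRing.scale/= mulr1 [h + x]addrC.
rewrite le_eqVlt; apply/orP; left; apply/eqP; congr (`| _ |).
by field.
Qed.

(** Outer regularity of Lebesgue measure, applied to the exceptional set. The end points are added
    to it because derivatives are only assumed at interior points: a point of [a, b] outside [U] is
    then interior. *)
Lemma ae_null_cover (P : R -> Prop) a b (d : R) : 0 < d ->
  (\forall t \ae mu, P t) ->
  exists U : set R, [/\ open U, U a, U b, forall t, ~ P t -> U t
    & (mu U < d%:E)%E].
Proof.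
move=> d0 [A [mA A0 PA]].
have mB : measurable (A `|` [set a; b]) by apply: measurableU => //; apply: measurableU.
have B0 : mu (A `|` [set a; b]) = 0%E.
  apply: (@measure_negligible _ _ _ mu) => //.
  apply: negligibleU; first by exists A; split.
  by apply: negligibleU; apply/negligibleP => //; exact: lebesgue_measure_set1.
have By : (mu (A `|` [set a; b]) < +oo)%E by rewrite B0.
have [U [oU BU Ud]] := lebesgue_regularity_outer mB By d0.
exists U; split => //.
- by apply: BU; right; left.
- by apply: BU; right; right.
- by move=> t /PA At; apply: BU; left.
- have -> : U = (A `|` [set a; b]) `|` (U `\` (A `|` [set a; b])).
    by rewrite setDUK.
  have mU : measurable U by exact: measurable_realfun.open_measurable.
  rewrite measureU//; last 2 first.
  + exact: measurableD.
  + by rewrite setDIK.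
  by rewrite [X in (X + _)%E](_ : _ = 0%E) ?add0e.
Qed.

(* A real induction (Cousin's lemma): from a to b one can proceed by finitely
   many steps, each of which either stays in an open set U of small measure or
   raises f by at most e times its length. *)
Lemma ac_nonincreasing a b f : a <= b -> ac a b f ->
  (\forall t \ae mu, a < t -> t < b -> exists2 d, d <= 0 & is_derive t 1 f d) ->
  f b <= f a.
Proof.
move=> ab acf fder; apply/ler_addgt0Pr => e0 e00.
(* The allowance [e0] is split into a slope [e] over the whole length b - a and one further [e] for
   all that happens inside [U]; hence the [+ 1]. *)
pose e := e0 / (b - a + 1).
have ba1 : 0 < b - a + 1 by lra.
have egt0 : 0 < e by rewrite divr_gt0.
have -> : e0 = e * (b - a) + e by rewrite /e; field; rewrite gt_eqF.
have [d d0 Hd] := acf e egt0.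
have [U [oU Ua Ub PU Ud]] := ae_null_cover a b d0 fder.
have mU : measurable U by exact: measurable_realfun.open_measurable.
(* The recorded intervals are the steps taken inside [U]. Their total length is compared with the
   measure of the part of [U] before x, not directly with [d], because that bound adds up from step
   to step; half-open intervals keep the pieces disjoint. *)
pose P x := exists k (l r : 'I_k -> R), [/\ disjoint_subintervals a x l r,
  ((\sum_i (r i - l i))%:E <= mu (U `&` `[a, x[))%E &
  f x - f a <= e * (x - a) + \sum_i `|f (r i) - f (l i)|].
have Pa : P a.
  exists 0%N, (fun=> a), (fun=> a); rewrite !big_ord0 !subrr mulr0 addr0.
  by split => //; split => -[].
have step (x : R) : a <= x -> x <= b -> exists2 eta, 0 < eta &
    forall l r, a <= l -> r <= b -> x - eta < l -> l <= x -> x <= r ->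
      r < x + eta -> P l -> P r.
  move=> ax xb.
  have [Ux|nUx] := pselect (U x).
    have [eta/= eta0 Heta] := open_nbhs_nbhs (conj oU Ux).
    exists eta => // l r al rb xl lx xr rx [k [L [R' [[H1 H1'] H2 H3]]]].
    have lr : l <= r by exact: le_trans xr.
    have lrU : `[l, r[ `<=` U.
      move=> y /=; rewrite in_itv/= => /andP[ly yr]; apply: Heta.
      by rewrite /ball/= ltr_norml; apply/andP; split; lra.
    exists k.+1, (fun i => if unlift ord0 i is Some j then L j else l),
      (fun i => if unlift ord0 i is Some j then R' j else r).
    split.
    + split => [i|i i'].
        case: unliftP => [j _|_]; last by split.
        by have [? ? ?] := H1 j; split => //; exact: le_trans lr.
      case: unliftP => [j ->|->]; case: unliftP => [j' ->|->] ii'.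
      * by apply: H1'; apply: contra ii' => /eqP ->.
      * by left; have [] := H1 j.
      * by right; have [] := H1 j'.
      * by rewrite eqxx in ii'.
    + rewrite big_ord_recl unlift_none.
      under eq_bigr do rewrite liftK.
      have -> : U `&` `[a, r[ = (U `&` `[a, l[) `|` `[l, r[.
        rewrite (@itv_bndbnd_setU _ _ (BLeft a) (BLeft l) (BLeft r)) ?bnd_simp//.
        by rewrite setIUr (setIidr lrU).
      rewrite EFinD measureU//; last 2 first.
      * exact: measurableI.
      * apply/seteqP; split => // y [[_ /=]]; rewrite !in_itv/= => /andP[_ yl].
        by move=> /andP[ly _]; rewrite ltNge ly in yl.
      have <- : mu `[l, r[ = (r - l)%:E.
        rewrite lebesgue_measure_itv/= lte_fin.
        case: ifPn => [_|]; first by rewrite -EFinD.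
        rewrite -leNgt => rl; have -> : r = l by apply/le_anti; rewrite rl lr.
        by rewrite subrr.
      by rewrite addeC; apply: leeD.
    + rewrite big_ord_recl unlift_none.
      under eq_bigr do rewrite liftK.
      have := ler_norm (f r - f l).
      have : 0 <= e * (r - l) by rewrite mulr_ge0 ?subr_ge0// ltW.
      by move: H3; rewrite !mulrBr; lra.
  (* Outside [U], x differs from both end points and has a nonpositive derivative. No interval is
     recorded; the increment is cut at x, where the expansion is centred. *)
  have ax' : a < x.
    by rewrite lt_neqAle ax andbT; apply/eqP => axE; apply: nUx; rewrite -axE.
  have xb' : x < b.
    by rewrite lt_neqAle xb andbT; apply/eqP => axE; apply: nUx; rewrite axE.
  have : a < x -> x < b -> exists2 d, d <= 0 & is_derive x 1 f d.
    by apply: contrapT => /PU.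
  move=> /(_ ax' xb') [df df0 fdf].
  have [eta eta0 Heta] := is_derive_increment fdf egt0.
  exists eta => // l r al rb xl lx xr rx [k [L [R' [[H1 H1'] H2 H3]]]].
  have lr : l <= r by exact: le_trans xr.
  exists k, L, R'; split.
  + by split => // i; have [? ? ?] := H1 i; split => //; exact: le_trans lr.
  + apply: le_trans H2 _; apply: le_measure; rewrite ?inE//.
    * exact: measurableI.
    * exact: measurableI.
    * apply: setIS; apply: subset_itvl; by rewrite bnd_simp.
  + have h1 : f r - f x <= e * (r - x).
      have := Heta (r - x); rewrite subrKC ger0_norm ?subr_ge0//.
      rewrite ltrBlDl => /(_ rx); rewrite ler_norml => /andP[_].
      have : df * (r - x) <= 0 by rewrite mulr_le0_ge0// subr_ge0.
      by lra.
    have h2 : f x - f l <= e * (x - l).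
      have := Heta (l - x); rewrite subrKC distrC ger0_norm ?subr_ge0//.
      rewrite ltrBlDl -ltrBlDr => /(_ xl); rewrite ler_norml => /andP[+ _].
      have : 0 <= df * (l - x) by rewrite mulr_le0// subr_le0.
      by lra.
    by move: H3 h1 h2; rewrite !mulrBr; lra.
pose A := [set x | [/\ a <= x, x <= b & P x]].
have A0 : has_sup A.
  by split; [exists a; split|exists b => x []].
have aA : a <= sup A by apply: sup_upper_bound.
have Ab : sup A <= b by apply: ge_sup; [exists a; split|move=> x []].
have [eta eta0 H] := step _ aA Ab.
have [l [al lb Pl] lA] := sup_adherent eta0 A0.
(* This either reaches b or passes strictly beyond the supremum, which is absurd. *)
pose r := Num.min b (sup A + eta / 2).
have lA' : l <= sup A by apply: sup_upper_bound.
have Ar : sup A <= r by rewrite /r le_min Ab/=; lra.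
have rA : r < sup A + eta by rewrite /r gt_min; apply/orP; right; lra.
have rb : r <= b by rewrite /r ge_min lexx.
have Pr : P r by apply: (H l r).
have : r <= sup A by apply: sup_upper_bound => //; split => //; exact: le_trans Ar.
have [rE|rE] : r = b \/ r = sup A + eta / 2.
  by rewrite /r; case: leP => _; [left|right].
  move=> _; move: Pr; rewrite rE => -[k [L [R' [H1 H2 H3]]]].
  (* The recorded intervals have total length less than [d], so absolute continuity bounds the
     increments over them. *)
  suff : \sum_i `|f (R' i) - f (L i)| < e by lra.
  apply: Hd => //; rewrite -lte_fin; apply: le_lt_trans H2 _.
  apply: le_lt_trans Ud; apply: le_measure; rewrite ?inE//.
  exact: measurableI.
by rewrite rE; lra.
Qed.

End AlmostEverywhereMonotone.

(** * Euclidean inner product and quadratic forms *)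

Section Dot.
Variable R : realType.

Definition dot m (x y : 'cV[R]_m) : R := (x^T *m y) 0 0.

Section Theory.
Variable m : nat.
Implicit Types (x y z : 'cV[R]_m) (c k : R) (M : 'M[R]_m).

Lemma dotE x y : dot x y = \sum_i x i 0 * y i 0.
Proof. by rewrite /dot mxE; apply: eq_bigr => i _; rewrite mxE. Qed.

Lemma dotC x y : dot x y = dot y x.
Proof. by rewrite !dotE; apply: eq_bigr => i _; rewrite mulrC. Qed.

Lemma dotDr x y z : dot x (y + z) = dot x y + dot x z.
Proof. by rewrite /dot mulmxDr mxE. Qed.

Lemma dotZr c x y : dot x (c *: y) = c * dot x y.
Proof. by rewrite /dot -scalemxAr mxE. Qed.

Lemma dotNr x y : dot x (- y) = - dot x y.
Proof. by rewrite -scaleN1r dotZr mulN1r. Qed.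

Lemma dotDl x y z : dot (x + y) z = dot x z + dot y z.
Proof. by rewrite dotC dotDr !(dotC z). Qed.

Lemma dotNl x y : dot (- x) y = - dot x y.
Proof. by rewrite dotC dotNr dotC. Qed.

Lemma dotZl c x y : dot (c *: x) y = c * dot x y.
Proof. by rewrite dotC dotZr dotC. Qed.

Lemma dot_ge0 x : 0 <= dot x x.
Proof. by rewrite dotE; apply: sumr_ge0 => i _; rewrite -expr2 sqr_ge0. Qed.

Lemma enorm_ge0 x : 0 <= enorm x.
Proof. exact: sqrtr_ge0. Qed.

Lemma enorm_sqrE x : enorm x = Num.sqrt (dot x x).
Proof. by rewrite /enorm dotE; under eq_bigr do rewrite expr2. Qed.

Lemma sqr_enorm x : enorm x ^+ 2 = dot x x.
Proof. by rewrite enorm_sqrE sqr_sqrtr ?dot_ge0. Qed.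

Lemma sqr_coord_le_dot x i : x i 0 ^+ 2 <= dot x x.
Proof.
rewrite dotE (bigD1 i)//= -expr2 lerDl sumr_ge0// => j _.
by rewrite -expr2 sqr_ge0.
Qed.

Lemma coord_le_enorm x i : `|x i 0| <= enorm x.
Proof. by rewrite enorm_sqrE -sqrtr_sqr ler_wsqrtr// sqr_coord_le_dot. Qed.

(** Expansion of |k x - y|^2 >= 0, divided by k. *)
Lemma young x y k : 0 < k -> 2 * dot x y <= k * dot x x + k^-1 * dot y y.
Proof.
move=> k0; have := dot_ge0 (k *: x - y).
rewrite !(dotDl, dotDr, dotZl, dotZr, dotNl, dotNr) (dotC y x) => h.
rewrite -(ler_pM2l k0) mulrDr !mulrA mulfV ?gt_eqF// mul1r; lra.
Qed.

(** A crude constant is enough: applied to Sigma, it enters the decay rate and the gains but not the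
    admissible range of T. The summand 1 makes it positive even for a zero matrix. *)
Lemma dot_mulmx_diag_le M : exists2 C, 0 < C &
  forall x, dot x (M *m x) <= C * dot x x.
Proof.
exists (1 + \sum_i \sum_j `|M i j|) => [|x].
  rewrite ltr_wpDr//; apply: sumr_ge0 => i _; exact: sumr_ge0.
rewrite dotE mulrDl mul1r mulr_suml (@le_trans _ _
  (\sum_i (\sum_j `|M i j|) * dot x x))//; last by rewrite lerDr dot_ge0.
apply: ler_sum => i _; rewrite mxE mulr_sumr mulr_suml.
apply: ler_sum => j _; apply: le_trans (ler_norm _) _.
rewrite mulrCA normrM ler_wpM2l// normrM.
have := sqr_coord_le_dot x i; have := sqr_coord_le_dot x j.
have nE (c : R) : c ^+ 2 = `|c| ^+ 2 by rewrite -normrX ger0_norm ?sqr_ge0.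
rewrite (nE (x i 0)) (nE (x j 0)).
have := sqr_ge0 (`|x i 0| - `|x j 0|); rewrite sqrrB; lra.
Qed.

End Theory.

Lemma dot_adj m p (x : 'cV[R]_m) (M : 'M[R]_(m, p)) y :
  dot x (M *m y) = dot (M^T *m x) y.
Proof. by rewrite /dot trmx_mul trmxK mulmxA. Qed.

Lemma dot_sym m (M : 'M[R]_m) x y : M^T = M -> dot x (M *m y) = dot y (M *m x).
Proof. by move=> MT; rewrite dot_adj MT dotC. Qed.

Lemma loewner_le_dot m (A B : 'M[R]_m) x : loewner_le A B ->
  dot x (A *m x) <= dot x (B *m x).
Proof.
by move=> [_ /(_ x)]; rewrite -mulmxA -/(dot _ _) mulmxBl dotDr dotNr subr_ge0.
Qed.

Lemma dot_scalar m (c : R) (x : 'cV[R]_m) : dot x (c%:M *m x) = c * dot x x.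
Proof. by rewrite mul_scalar_mx dotZr. Qed.

End Dot.

(** * The Lyapunov function, for abstract symmetric weights *)

Section Lyapunov.
Variables (R : realType) (m : nat) (Q S : 'M[R]_m).
Implicit Types (x z g : 'cV[R]_m) (tau r : R).

Definition lyap x z tau : R :=
  4^-1 * dot (z - x) (Q *m (z - x)) + 4^-1 * dot z (Q *m z)
  + tau ^+ 2 / 2 * dot x (S *m x).

(** What the chain rule gives for [lyap] with velocities [dx], [dz], [r] when [Q] and [S] are
    symmetric. Being purely algebraic, it separates the estimates from differentiation. *)
Definition lyap_der x z tau dx dz r : R :=
  2^-1 * dot (z - x) (Q *m (dz - dx)) + 2^-1 * dot z (Q *m dz)
  + tau * r * dot x (S *m x) + tau ^+ 2 * dot x (S *m dx).

(* The choice of the factors 1/4, 1/4, 1/2 in lyap cancels the cross term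
   between z - x and S x. *)
Lemma lyap_der_flow (M : 'M[R]_m) x z tau r F g : S^T = S -> 0 < tau ->
  Q *m F = (S + M) *m x - g ->
  lyap_der x z tau ((2 / tau) *: (z - x)) (- (2 * tau) *: F) r =
  - tau^-1 * dot (z - x) (Q *m (z - x)) - tau * (1 - r) * dot x (S *m x)
  - 2 * tau * dot (z - x) (M *m x) - tau * dot x (M *m x)
  + tau * (2 * dot (z - x) g + dot x g).
Proof.
move=> ST tau0 QF; rewrite /lyap_der.
have zE : z = (z - x) + x by rewrite subrK.
move: (z - x) zE => w ->.
rewrite mulmxBr -!scalemxAr QF mulmxDl.
rewrite !(dotDl, dotDr, dotZl, dotZr, dotNl, dotNr) (dot_sym w x ST).
by field; rewrite gt_eqF.
Qed.

Variables (a A sigma S1 T0 T : R).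
Hypotheses (a0 : 0 < a) (A0 : 0 < A) (sigma0 : 0 < sigma) (S10 : 0 < S1).
Hypotheses (T00 : 0 < T0) (T0T : T0 < T).
Hypotheses (QT : Q^T = Q) (ST : S^T = S).
Hypotheses (Qge : forall x, a * dot x x <= dot x (Q *m x)).
Hypotheses (Qle : forall x, dot x (Q *m x) <= A * dot x x).
Hypotheses (Sge : forall x, sigma * dot x x <= dot x (S *m x)).
Hypotheses (Sle : forall x, dot x (S *m x) <= S1 * dot x x).

Let Qge0 x : 0 <= dot x (Q *m x).
Proof. by apply: le_trans (Qge x); rewrite mulr_ge0 ?dot_ge0 ?ltW. Qed.

Let Sge0 x : 0 <= dot x (S *m x).
Proof. by apply: le_trans (Sge x); rewrite mulr_ge0 ?dot_ge0 ?ltW. Qed.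

Let T_gt0 : 0 < T. Proof. exact: lt_trans T0T. Qed.

Lemma Q_parallelogram x z :
  dot (x + z) (Q *m (x + z)) <= 2 * (dot x (Q *m x) + dot z (Q *m z)).
Proof.
have := Qge0 (x - z).
rewrite !(mulmxDr, mulmxN, dotDl, dotDr, dotNl, dotNr) (dot_sym z x QT); lra.
Qed.

Lemma lyap_ge0 x z tau : 0 <= lyap x z tau.
Proof.
have h : 0 <= tau ^+ 2 / 2 * dot x (S *m x).
  by rewrite mulr_ge0 ?Sge0// divr_ge0 ?sqr_ge0.
have := Qge0 (z - x); have := Qge0 z; rewrite /lyap; lra.
Qed.

Lemma lyap_lower : exists2 c, 0 < c & forall x z tau, T0 <= tau ->
  c * (dot x x + dot z z) <= lyap x z tau.
Proof.
exists (Num.min (a / 4) (T0 ^+ 2 / 2 * sigma)) => [|x z tau Ttau].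
  by rewrite lt_min !mulr_gt0 ?invr_gt0 ?exprn_gt0.
set c := Num.min _ _.
have h1 : c * dot z z <= a / 4 * dot z z.
  by rewrite ler_wpM2r ?dot_ge0// ge_min lexx.
have h2 : c * dot x x <= T0 ^+ 2 / 2 * sigma * dot x x.
  by rewrite ler_wpM2r ?dot_ge0// ge_min lexx orbT.
have h3 : T0 ^+ 2 / 2 * (sigma * dot x x) <= tau ^+ 2 / 2 * dot x (S *m x).
  have tt : T0 ^+ 2 / 2 <= tau ^+ 2 / 2.
    by rewrite ler_pM2r// lerXn2r// ?nnegrE ltW// (lt_le_trans T00).
  have t0 : 0 <= T0 ^+ 2 / 2 by rewrite divr_ge0 ?sqr_ge0.
  exact: le_trans (ler_wpM2l t0 (Sge x)) (ler_wpM2r (Sge0 x) tt).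
have := Qge z; have := Qge0 (z - x); rewrite /lyap; lra.
Qed.

(** The bound in (x, z) compares V with the distance to the attractor; the one in (x, z - x) matches
    the variables in which the flow dissipates. *)
Lemma lyap_upper : exists2 c, 0 < c & forall x z tau, T0 <= tau -> tau <= T ->
  lyap x z tau <= c * (dot x x + dot z z)
  /\ lyap x z tau <= c * (dot x x + dot (z - x) (z - x)).
Proof.
exists (A + T ^+ 2 / 2 * S1) => [|x z tau Ttau tauT].
  by rewrite addr_gt0 ?mulr_gt0 ?invr_gt0 ?exprn_gt0.
have h : tau ^+ 2 / 2 * dot x (S *m x) <= T ^+ 2 / 2 * (S1 * dot x x).
  have tau0 : 0 < tau by exact: lt_le_trans T00 Ttau.
  have tt : tau ^+ 2 / 2 <= T ^+ 2 / 2.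
    by rewrite ler_pM2r// lerXn2r// ?nnegrE ltW.
  have t0 : 0 <= T ^+ 2 / 2 by rewrite divr_ge0 ?sqr_ge0.
  exact: le_trans (ler_wpM2r (Sge0 x) tt) (ler_wpM2l t0 (Sle x)).
have h0 (v : 'cV[R]_m) : 0 <= T ^+ 2 / 2 * S1 * dot v v.
  by rewrite !mulr_ge0 ?dot_ge0 ?sqr_ge0 ?invr_ge0 ?ltW.
have h0' (v : 'cV[R]_m) : 0 <= A * dot v v by rewrite mulr_ge0 ?dot_ge0 ?ltW.
have Nx : dot (- x) (Q *m - x) = dot x (Q *m x).
  by rewrite mulmxN dotNl dotNr opprK.
split.
  have := Q_parallelogram z (- x); rewrite Nx.
  have := Qle z; have := Qle x; have := h0 z; have := h0' x; have := h0' z.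
  rewrite /lyap; lra.
have := Q_parallelogram (z - x) x; rewrite subrK.
have := Qle (z - x); have := Qle x; have := h0 (z - x).
have := h0' x; have := h0' (z - x); rewrite /lyap; lra.
Qed.

(** [lam] and [K] are chosen before [M], since in the application [M] depends on time. *)
Lemma lyap_decrease (D omega : R) : omega < 1 -> 0 <= D ->
  T ^+ 2 * D < a * (1 - omega) * sigma ->
  exists lam K, [/\ 0 < lam, 0 < K & forall (M : 'M[R]_m),
    (forall v, dot (M^T *m v) (M^T *m v) <= D * dot v v) ->
    (forall v, 0 <= dot v (M *m v)) ->
    forall x z tau r F g, T0 <= tau -> tau <= T -> r <= omega ->
    Q *m F = (S + M) *m x - g ->
    lyap_der x z tau ((2 / tau) *: (z - x)) (- (2 * tau) *: F) r <=
    - lam * lyap x z tau + K * dot g g].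
Proof.
move=> omega1 D0 TD.
pose b := (1 - omega) * sigma.
have b0 : 0 < b by rewrite mulr_gt0 ?subr_gt0.
have TDab : T ^+ 2 * D / a < b by rewrite ltr_pdivrMr// [ltRHS]mulrC /b mulrA.
have TD0 : 0 <= T ^+ 2 * D / a.
  by rewrite divr_ge0 ?(ltW a0)// mulr_ge0 ?sqr_ge0.
(* The Young weight for the term in [M]: the midpoint of the window left open by the condition on T.
   Being above the lower end keeps [e1] positive, being below the upper end keeps [e2] positive. *)
pose k := (T ^+ 2 * D / a + b) / 2.
have k0 : 0 < k by rewrite /k; lra.
have kb : k < b by rewrite /k; lra.
have TDk : T ^+ 2 * D / a < k by rewrite /k; lra.
(* [e1] and [e2] are the dissipation left on |z - x|^2 and |x|^2 after absorbing the term in [M], at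
   the worst values tau = T and tau = T0 respectively. Half of each pays for the input [g] (whence
   the constant [K]); the other half gives [lam]. *)
pose e1 := (a - T ^+ 2 * D / k) / T.
pose e2 := T0 * (b - k).
have e10 : 0 < e1.
  by rewrite divr_gt0// subr_gt0 ltr_pdivrMr// [ltRHS]mulrC -ltr_pdivrMr.
have e20 : 0 < e2 by rewrite mulr_gt0// subr_gt0.
have [c2 c20 Vle] := lyap_upper.
pose lam := Num.min e1 e2 / (2 * c2).
exists lam, (2 * T ^+ 2 / e1 + T ^+ 2 / (2 * e2)); split.
- by rewrite divr_gt0 ?mulr_gt0// lt_min e10.
- have TT : 0 < T ^+ 2 by rewrite exprn_gt0.
  by apply: addr_gt0; apply: divr_gt0 => //; exact: mulr_gt0.
move=> M MD M0 x z tau r F g Ttau tauT rom QF.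
have tau0 : 0 < tau by exact: lt_le_trans T00 Ttau.
rewrite (lyap_der_flow _ _ ST tau0 QF).
have [_ Vle'] := Vle x z tau Ttau tauT.
move: (z - x) Vle' => w Vle'.
have xx := dot_ge0 x; have ww := dot_ge0 w; have gg := dot_ge0 g.
have h1 : tau^-1 * (a * dot w w) <= tau^-1 * dot w (Q *m w).
  by rewrite ler_pM2l ?invr_gt0.
have h2 : tau * (b * dot x x) <= tau * (1 - r) * dot x (S *m x).
  rewrite /b -!mulrA ler_pM2l//; apply: ler_pM; rewrite ?mulr_ge0//.
  - by lra.
  - exact: ltW.
  - by lra.
(* [M] is moved onto w first, because the hypothesis controls its transpose. *)
have h3 : - (2 * tau * dot w (M *m x)) <= tau * (k^-1 * D * dot w w + k * dot x x).
  rewrite dot_adj.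
  have ki : 0 < k^-1 by rewrite invr_gt0.
  have := young (- (M^T *m w)) x ki; rewrite invrK !dotNl dotNr opprK => h.
  have h' : k^-1 * dot (M^T *m w) (M^T *m w) <= k^-1 * (D * dot w w).
    by rewrite ler_pM2l// MD.
  rewrite (_ : - _ = tau * (2 * - dot (M^T *m w) x)); last by ring.
  by rewrite ler_pM2l//; lra.
have h4 : e1 * dot w w <= tau^-1 * (a * dot w w) - tau * (k^-1 * D * dot w w).
  have -> : tau^-1 * (a * dot w w) - tau * (k^-1 * D * dot w w)
    = (a / tau - tau * D / k) * dot w w by ring.
  rewrite ler_wpM2r//.
  have -> : e1 = a / T - T * D / k by rewrite /e1; field; rewrite !gt_eqF.
  rewrite lerB//.
    by rewrite ler_pM2l// lef_pV2// ?posrE.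
  by rewrite ler_wpM2r ?invr_ge0 ?(ltW k0)// ler_wpM2r.
have h5 : e2 * dot x x <= tau * (b * dot x x) - tau * (k * dot x x).
  rewrite -mulrBr -mulrBl mulrA ler_wpM2r// ler_wpM2r// subr_ge0 ltW//.
have h6 : 0 <= tau * dot x (M *m x) by rewrite mulr_ge0// ltW.
have tau2 : tau ^+ 2 <= T ^+ 2 by rewrite lerXn2r// ?nnegrE ltW.
have h7 : tau * (2 * dot w g) <= e1 / 2 * dot w w + 2 * T ^+ 2 / e1 * dot g g.
  have e120 : 0 < e1 / 2 by rewrite divr_gt0.
  have := young w (tau *: g) e120; rewrite !dotZr dotZl => h.
  have : (e1 / 2)^-1 * (tau * (tau * dot g g)) <= 2 * T ^+ 2 / e1 * dot g g.
    have -> : (e1 / 2)^-1 * (tau * (tau * dot g g)) = 2 / e1 * (tau ^+ 2 * dot g g).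
      by field; rewrite gt_eqF.
    have -> : 2 * T ^+ 2 / e1 * dot g g = 2 / e1 * (T ^+ 2 * dot g g) by ring.
    have e1i : 0 < 2 / e1 by exact: divr_gt0.
    by rewrite (ler_pM2l e1i) (ler_wpM2r gg tau2).
  lra.
have h8 : tau * dot x g <= e2 / 2 * dot x x + T ^+ 2 / (2 * e2) * dot g g.
  have := young x (tau *: g) e20; rewrite !dotZr dotZl => h.
  have : e2^-1 * (tau * (tau * dot g g)) <= 2 * (T ^+ 2 / (2 * e2) * dot g g).
    have -> : 2 * (T ^+ 2 / (2 * e2) * dot g g) = e2^-1 * (T ^+ 2 * dot g g).
      by field; rewrite gt_eqF.
    have e2i : 0 < e2^-1 by rewrite invr_gt0.
    by rewrite (ler_pM2l e2i) mulrA -expr2 (ler_wpM2r gg tau2).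
  lra.
have h9 : lam * lyap x z tau <= e1 / 2 * dot w w + e2 / 2 * dot x x.
  have lam0 : 0 < lam by rewrite divr_gt0 ?mulr_gt0// lt_min e10.
  apply: (@le_trans _ _ (lam * (c2 * (dot x x + dot w w)))).
    by rewrite ler_pM2l.
  have -> : lam * (c2 * (dot x x + dot w w))
    = Num.min e1 e2 / 2 * (dot x x + dot w w).
    by rewrite /lam; field; rewrite gt_eqF.
  have : Num.min e1 e2 * dot w w <= e1 * dot w w.
    by rewrite ler_wpM2r// ge_min lexx.
  have : Num.min e1 e2 * dot x x <= e2 * dot x x.
    by rewrite ler_wpM2r// ge_min lexx orbT.
  lra.
lra.
Qed.

(** The hypotheses make [P] behave as a Q-orthogonal projection. With w = z - x, the Q-terms then
    change by a quarter of x^T QP x - z^T QP z - w^T QP w, which is at most A/4 |x|^2. Resetting tau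
    from T to T0 releases (T^2 - T0^2)/2 x^T S x, which covers this. *)
Lemma lyap_jump (P : 'M[R]_m) x z :
  (Q *m P)^T = Q *m P -> P^T *m (Q *m P) = Q *m P ->
  (forall v, 0 <= dot v (Q *m P *m v)) ->
  (forall v, dot v (Q *m P *m v) <= A * dot v v) ->
  A / (2 * sigma) + T0 ^+ 2 <= T ^+ 2 ->
  lyap x (z + P *m (x - z)) T0 <= lyap x z T.
Proof.
move=> QPT PQP QP0 QPA TT.
have xz : x - z = - (z - x) by rewrite opprB.
rewrite xz /lyap addrAC.
have zE : z = (z - x) + x by rewrite subrK.
move: (z - x) zE => w ->.
have PQ v u : dot (P *m v) (Q *m u) = dot u (Q *m P *m v).
  by rewrite dot_sym// mulmxA.
have PQPE v u : dot (P *m v) (Q *m P *m u) = dot u (Q *m P *m v).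
  by rewrite dotC dot_adj mulmxA PQP dotC (dot_sym _ _ QPT).
rewrite !(mulmxDr, mulmxN, mulmxA, dotDl, dotDr, dotNl, dotNr).
rewrite !PQ !PQPE ?(dot_sym w x QPT) ?(dot_sym w x QT).
have hA := QPA x; have hw := QP0 w; have hz := QP0 (w + x).
have hS := Sge x.
move: hz; rewrite mulmxDr !(dotDl, dotDr) (dot_sym w x QPT) => hz.
have h1 : A * dot x x <= 2 * (T ^+ 2 - T0 ^+ 2) * dot x (S *m x).
  have TT0 : 0 <= 2 * (T ^+ 2 - T0 ^+ 2).
    have : 0 <= A / (2 * sigma) by rewrite divr_ge0 ?mulr_ge0 ?ltW.
    lra.
  apply: le_trans (ler_wpM2l TT0 hS); rewrite mulrA ler_wpM2r ?dot_ge0//.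
  have -> : A = A / (2 * sigma) * (2 * sigma) by field; rewrite gt_eqF.
  have -> : 2 * (T ^+ 2 - T0 ^+ 2) * sigma = (T ^+ 2 - T0 ^+ 2) * (2 * sigma).
    ring.
  by rewrite ler_pM2r ?mulr_gt0//; lra.
lra.
Qed.

(** A full restart puts z at x, so the term in z - x vanishes. As x^T Q x <= (A / sigma) x^T S x,
    what remains is a multiple of x^T S x, to be compared with the share T^2/2 x^T S x of the old
    value. *)
Lemma lyap_restart x z :
  lyap x x T0 <= (A / (2 * sigma) + T0 ^+ 2) / T ^+ 2 * lyap x z T.
Proof.
have h : T ^+ 2 / 2 * dot x (S *m x) <= lyap x z T.
  rewrite /lyap; have := Qge0 (z - x); have := Qge0 z; lra.
have c0 : 0 <= (A / (2 * sigma) + T0 ^+ 2) / T ^+ 2.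
  by rewrite divr_ge0 ?addr_ge0 ?divr_ge0 ?mulr_ge0 ?sqr_ge0 ?ltW.
apply: le_trans (ler_wpM2l c0 h); rewrite /lyap subrr mulmx0 dotC /dot trmx0.
rewrite mul0mx mxE mulr0 add0r -/(dot _ _).
have -> : (A / (2 * sigma) + T0 ^+ 2) / T ^+ 2 * (T ^+ 2 / 2 * dot x (S *m x))
  = A / (4 * sigma) * dot x (S *m x) + T0 ^+ 2 / 2 * dot x (S *m x).
  by field; rewrite !gt_eqF.
rewrite lerD2r.
have := Qle x => hQ; have := Sge x => hS.
have A4 : 0 <= A / (4 * sigma) by rewrite divr_ge0 ?mulr_ge0 ?ltW.
have := ler_wpM2l A4 hS.
have -> : A / (4 * sigma) * (sigma * dot x x) = 4^-1 * (A * dot x x).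
  by field; rewrite gt_eqF.
lra.
Qed.

End Lyapunov.

(** * Stacked vectors and Kronecker products, block by block *)

Section Blocks.
Variables (R : realType) (N n : nat).
Implicit Types (x y : 'cV[R]_(N * n)) (i : 'I_N).

Lemma blockE x i j : block i x j 0 = x (mxtens_index (i, j)) 0.
Proof. by rewrite mxE. Qed.

Lemma block_inj x y : (forall i, block i x = block i y) -> x = y.
Proof.
move=> H; apply/colP => k; rewrite -(mxtens_unindexK k).
by case: (mxtens_unindex k) => i j; rewrite -!blockE H.
Qed.

Lemma blockD i x y : block i (x + y) = block i x + block i y.
Proof. by apply/colP => j; rewrite !mxE. Qed.

Lemma blockN i x : block i (- x) = - block i x.
Proof. by apply/colP => j; rewrite !mxE. Qed.

Lemma blockZ i (c : R) x : block i (c *: x) = c *: block i x.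
Proof. by apply/colP => j; rewrite !mxE. Qed.

Lemma block_stack i (v : 'I_N -> 'cV[R]_n) : block i (stack v) = v i.
Proof. by apply/colP => j; rewrite !mxE mxtens_indexK. Qed.

Lemma block_consensus i (th : 'cV[R]_n) : block i (consensus N th) = th.
Proof. by apply/colP => j; rewrite !mxE mxtens_indexK mul1r ord1. Qed.

Lemma sum_mxtens_index (F : 'I_(N * n) -> R) :
  \sum_k F k = \sum_i \sum_j F (mxtens_index (i, j)).
Proof.
rewrite (reindex (@mxtens_index N n)) /=; last first.
  by exists (@mxtens_unindex N n) => ? _; rewrite (mxtens_indexK, mxtens_unindexK).
rewrite pair_bigA; by apply: eq_bigr => -[].
Qed.

Lemma dot_block x y : dot x y = \sum_i dot (block i x) (block i y).
Proof.
rewrite dotE sum_mxtens_index; apply: eq_bigr => i _.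
by rewrite dotE; apply: eq_bigr => j _; rewrite !mxE.
Qed.

Lemma block_tens_mul (A : 'M[R]_N) (B : 'M[R]_n) i x :
  block i ((A *t B) *m x) = \sum_k A i k *: (B *m block k x).
Proof.
apply/colP => j; rewrite mxE mxE sum_mxtens_index summxE.
apply: eq_bigr => k _; rewrite !mxE mulr_sumr; apply: eq_bigr => l _.
by rewrite tensmxE !mxE mulrA.
Qed.

Lemma block_sum i (I : Type) (r : seq I) (P : pred I) (F : I -> 'cV[R]_(N * n)) :
  block i (\sum_(k <- r | P k) F k) = \sum_(k <- r | P k) block i (F k).
Proof.
elim/big_rec2: _ => [|k a b _ <-]; last by rewrite blockD.
by apply/colP => j; rewrite !mxE.
Qed.

Lemma block_block_diag (B : 'I_N -> 'M[R]_n) i x :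
  block i (block_diag B *m x) = B i *m block i x.
Proof.
rewrite /block_diag mulmx_suml block_sum (bigD1 i)//= big1 => [|k ki].
  rewrite addr0 block_tens_mul (bigD1 i)//= big1 => [|l li].
    by rewrite addr0 mxE !eqxx scale1r.
  by rewrite mxE eqxx/= (negPf li) scale0r.
rewrite block_tens_mul big1// => l _.
by rewrite mxE eq_sym (negPf ki) scale0r.
Qed.

Lemma block_kronI (A : 'M[R]_N) i x :
  block i (kronI n A *m x) = \sum_k A i k *: block k x.
Proof. by rewrite block_tens_mul; under eq_bigr do rewrite mul1mx. Qed.

Lemma block_kronI_diag (d : 'rV[R]_N) i x :
  block i (kronI n (diag_mx d) *m x) = d 0 i *: block i x.
Proof.
rewrite block_kronI (bigD1 i)//= big1 => [|k ki]; rewrite mxE.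
  by rewrite eqxx addr0 mulr1n.
by rewrite eq_sym (negPf ki) mulr0n scale0r.
Qed.

Lemma dot_kronI_diag (d : 'rV[R]_N) x y :
  dot x (kronI n (diag_mx d) *m y) = \sum_i d 0 i * dot (block i x) (block i y).
Proof.
by rewrite dot_block; apply: eq_bigr => i _; rewrite block_kronI_diag dotZr.
Qed.

Lemma dot_kronI_diag_ge0 (d : 'rV[R]_N) x :
  (forall i, 0 <= d 0 i) -> 0 <= dot x (kronI n (diag_mx d) *m x).
Proof.
by move=> d0; rewrite dot_kronI_diag sumr_ge0// => i _; rewrite mulr_ge0 ?dot_ge0.
Qed.

Lemma dot_kronI_diag_le (d : 'rV[R]_N) (c : R) x :
  (forall i, d 0 i <= c) -> dot x (kronI n (diag_mx d) *m x) <= c * dot x x.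
Proof.
move=> dc; rewrite dot_kronI_diag dot_block mulr_sumr.
by apply: ler_sum => i _; rewrite ler_wpM2r ?dot_ge0.
Qed.

Lemma dot_kronI_diag_lower (d : 'rV[R]_N) (c : R) x :
  (forall i, c <= d 0 i) -> c * dot x x <= dot x (kronI n (diag_mx d) *m x).
Proof.
move=> dc; rewrite dot_kronI_diag dot_block mulr_sumr.
by apply: ler_sum => i _; rewrite ler_wpM2r ?dot_ge0.
Qed.

Lemma kronI_diag_sym (d : 'rV[R]_N) :
  (kronI n (diag_mx d))^T = kronI n (diag_mx d).
Proof. by rewrite /kronI trmx_tens tr_diag_mx trmx1. Qed.

Lemma kronI_diagM (d e : 'rV[R]_N) :
  kronI n (diag_mx d) *m kronI n (diag_mx e) =
  kronI n (diag_mx (\row_i (d 0 i * e 0 i))).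
Proof. by rewrite /kronI tensmx_mul mulmx1 mulmx_diag. Qed.

Lemma kronI_laplacian_consensus (A : 'M[R]_N) (th : 'cV[R]_n) :
  (forall i, \sum_j A i j = 0) -> kronI n A *m consensus N th = 0.
Proof.
move=> A0; apply: block_inj => i; rewrite block_kronI.
under eq_bigr do rewrite block_consensus.
by rewrite -scaler_suml A0 scale0r; apply/colP => j; rewrite !mxE.
Qed.

Lemma qmin_le (q : 'cV[R]_N) i : qmin q <= q i 0.
Proof.
apply: ge_inf; last by exists i.
exists (- \sum_j `|q j 0|) => _ [j _ <-].
rewrite lerNl (le_trans (ler_norm _))// normrN (bigD1 j)//= lerDl.
exact: sumr_ge0.
Qed.

Lemma qmax_ge (q : 'cV[R]_N) i : q i 0 <= qmax q.
Proof.
apply: ub_le_sup; last by exists i.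
exists (\sum_j `|q j 0|) => _ [j _ <-].
rewrite (le_trans (ler_norm _))// (bigD1 j)//= lerDl.
exact: sumr_ge0.
Qed.

(** An infimum of positive numbers could vanish; over finitely many agents the minimum [c] is a
    positive lower bound, and [N > 0] keeps the range nonempty. *)
Lemma qmin_gt0 (q : 'cV[R]_N) : (0 < N)%N -> (forall i, 0 < q i 0) -> 0 < qmin q.
Proof.
move=> N0 q0; pose i0 := Ordinal N0.
pose c := \big[Order.min/q i0 0]_j q j 0.
have c0 : 0 < c by rewrite /c lt_bigmin.
apply: lt_le_trans c0 _; apply: lb_le_inf; first by exists (q i0 0), i0.
by move=> _ [j _ <-]; exact: bigmin_le.
Qed.

End Blocks.

(** * The Lyapunov estimates for the network data *)

Section Network.
Variables (R : realType) (N n : nat) (phi : 'I_N -> R -> 'cV[R]_n).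
Variables (kbar : 'I_N -> nat) (trec : forall i, 'I_(kbar i) -> R).
Variables (L : 'M[R]_N) (kr kc kt : R) (q : 'cV[R]_N) (thetastar : 'cV[R]_n).
Implicit Types (theta x v : 'cV[R]_(N * n)) (u : 'cV[R]_(input_dim kbar)).

(** The disturbance [g] of [lyap_der_flow]: both noises, carried by their regressors and weighted by
    Q. *)
Definition input_drive (s : R) u : 'cV[R]_(N * n) :=
  bQ n q *m (kt *: stack (fun i => phi i s *m (in_upsilon u i)%:M)
   + kr *: stack (fun i => \sum_(k < kbar i) phi i (trec k) *m (in_nu u k)%:M)).

(* The part of the flow matrix Q (kt A + kr Delta + kc L) left after removing
   Sigma; it is positive semidefinite since Omega is skew-symmetric. *)
Definition flow_skew (s : R) : 'M[R]_(N * n) :=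
  bOmega n L kc q + kt *: (bQ n q *m bA phi s).

Lemma bPsiE theta s u : bPsi phi thetastar theta s u =
  bA phi s *m (theta - consensus N thetastar)
  - stack (fun i => phi i s *m (in_upsilon u i)%:M).
Proof.
apply: block_inj => i; rewrite blockD blockN !block_stack block_block_diag.
by rewrite blockD blockN block_consensus !mulmxBr !mulmxA.
Qed.

Lemma bPhiE theta u : bPhi phi trec thetastar theta u =
  bDelta phi trec *m (theta - consensus N thetastar)
  - stack (fun i => \sum_(k < kbar i) phi i (trec k) *m (in_nu u k)%:M).
Proof.
apply: block_inj => i; rewrite blockD blockN !block_stack block_block_diag.
rewrite blockD blockN block_consensus mulmx_suml -sumrB.
by apply: eq_bigr => k _; rewrite !mulmxBr !mulmxA.
Qed.

(** Zero row sums let L act on the error instead of theta. Then kc Q L splits into its symmetric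
    part, which belongs to Sigma, and its skew part Omega. *)
Lemma bQ_flow theta s u : (forall i, \sum_j L i j = 0) ->
  bQ n q *m (kt *: bPsi phi thetastar theta s u
    + kr *: bPhi phi trec thetastar theta u + kc *: (kronI n L *m theta)) =
  (bSigma phi trec L kr kc q + flow_skew s) *m (theta - consensus N thetastar)
  - input_drive s u.
Proof.
move=> L0; rewrite bPsiE bPhiE.
have -> : kronI n L *m theta = kronI n L *m (theta - consensus N thetastar).
  by rewrite mulmxBr kronI_laplacian_consensus// subr0.
move: (theta - consensus N thetastar) => x.
rewrite /input_drive /bSigma /flow_skew /bOmega.
move: (stack _) (stack _) => g1 g2.
rewrite !(mulmxDr, mulmxDl, mulmxN, mulNmx, scalerDr, scalerN).
rewrite -?(scalemxAl, scalemxAr) !(mulmxA, scalerDr, scalerN).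
move: (_ *m g1) (_ *m g2) (_ *m bA phi s *m x) (_ *m bDelta phi trec *m x).
move: (_ *m kronI n L *m x) (_ *m bQ n q *m x) => a1 a2 a3 a4 a5 a6.
by apply/colP => i; rewrite !mxE; field.
Qed.

Lemma bQ_sym : (bQ n q)^T = bQ n q.
Proof. exact: kronI_diag_sym. Qed.

Lemma flow_skew_ge0 s v : 0 <= kt -> (forall i, 0 <= q i 0) ->
  0 <= dot v (flow_skew s *m v).
Proof.
move=> kt0 q0; rewrite /flow_skew mulmxDl dotDr addr_ge0//.
  rewrite /bOmega -scalemxAl dotZr mulmxBl dotDr dotNr -!mulmxA.
  rewrite (dot_adj v (_^T)) trmxK dotC.
  rewrite [X in _ * (X - _)](_ : _ = dot (kronI n L *m v) (bQ n q *m v)).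
    by rewrite dotC subrr mulr0.
  by rewrite dot_adj bQ_sym.
rewrite -scalemxAl dotZr mulr_ge0// -mulmxA dot_kronI_diag sumr_ge0// => i _.
rewrite mxE mulr_ge0// block_block_diag -mulmxA dot_adj -?dotC dot_ge0//.
Qed.

(** [chi_bound] concerns M M^T, hence the size of M^T v; this is why [lyap_decrease] asks for a
    bound on the transpose. *)
Lemma flow_skew_tr_le chi s v : 0 <= kt -> 0 <= s -> chi_bound phi L kc q chi ->
  dot ((flow_skew s)^T *m v) ((flow_skew s)^T *m v) <=
  (max_singular_value (bOmega n L kc q) ^+ 2 + chi kt ^+ 2) * dot v v.
Proof.
move=> kt0 s0 /(_ kt s kt0 s0) /= /loewner_le_dot - /(_ v).
by rewrite dot_scalar -mulmxA dot_adj.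
Qed.

(** Estimated by coordinates. The current regressor is bounded uniformly in time by [B], while the
    recorded ones, finitely many, enter through their actual values; so the constant does not depend
    on [s]. *)
Lemma input_drive_le :
  (forall i, exists B : R, forall t, 0 <= t -> enorm (phi i t) <= B) ->
  exists2 C, 0 < C & forall s u, 0 <= s ->
    dot (input_drive s u) (input_drive s u) <= C * enorm u ^+ 2.
Proof.
move=> /choice[B HB].
pose c (k : 'I_(N * n)) : R := let i := (mxtens_unindex k).1 in
  let j := (mxtens_unindex k).2 in
  `|q i 0| * (`|kt| * B i + `|kr| * \sum_(l < kbar i) `|phi i (trec l) j 0|).
exists (1 + \sum_k c k ^+ 2) => [|s u s0].
  by rewrite ltr_wpDr// sumr_ge0// => k _; exact: sqr_ge0.
rewrite mulrDl mul1r (@le_trans _ _ ((\sum_k c k ^+ 2) * enorm u ^+ 2))//; last first.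
  by rewrite lerDr sqr_ge0.
rewrite dotE mulr_suml; apply: ler_sum => k _.
have in_le i (l : 'I_(kbar i)) : `|in_nu u l| <= enorm u.
  by rewrite /in_nu !mxE; exact: coord_le_enorm.
have up_le i : `|in_upsilon u i| <= enorm u.
  by rewrite /in_upsilon mxE; exact: coord_le_enorm.
have u0 := enorm_ge0 u.
suff H : `|input_drive s u k 0| <= c k * enorm u.
  rewrite -expr2 -exprMn -[leLHS]ger0_norm ?sqr_ge0// normrX.
  by rewrite lerXn2r// ?nnegrE//; exact: le_trans H.
rewrite -(mxtens_unindexK k) /c mxtens_indexK.
case: (mxtens_unindex k) => i j /=.
rewrite -blockE block_kronI_diag mxE normrM mxE -mulrA ler_wpM2l//.
rewrite blockD !blockZ !block_stack mulrDl mxE.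
apply: le_trans (ler_normD _ _) _.
rewrite [X in `|X| + _]mxE [X in _ + `|X|]mxE !normrM -!mulrA.
apply: lerD; apply: ler_wpM2l => //.
  rewrite mxE big_ord1 mxE eqxx mulr1n normrM; apply: ler_pM => //.
  exact: le_trans (coord_le_enorm _ _) (HB _ _ s0).
rewrite summxE mulr_suml; apply: le_trans (ler_norm_sum _ _ _) _.
apply: ler_sum => l _; rewrite mxE big_ord1 [X in _ * X]mxE eqxx mulr1n normrM.
by rewrite ler_wpM2l.
Qed.

(** The squared, division-free form also covers the case of a zero denominator, where Tup is
    infinite and the left side vanishes. *)
Lemma Tup_sqr_lt sigS chi omega T : 0 < sigS -> omega < 1 -> 0 < T ->
  0 < qmin q ->
  (T%:E < Tup n L kc q sigS chi kt omega)%E ->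
  T ^+ 2 * (max_singular_value (bOmega n L kc q) ^+ 2 + chi kt ^+ 2) <
  qmin q * (1 - omega) * sigS.
Proof.
move=> sig0 om1 T0 q0; rewrite /Tup; set D := (_ + _).
have X0 : 0 < qmin q * (1 - omega) * sigS by rewrite !mulr_gt0 ?subr_gt0.
case: ifPn => [/eqP ->|D0]; first by rewrite mulr0.
have {}D0 : 0 < D by rewrite lt_neqAle eq_sym D0 addr_ge0 ?sqr_ge0.
rewrite lte_fin => TD; rewrite -ltr_pdivlMr//.
rewrite -[ltRHS]sqr_sqrtr; last by rewrite divr_ge0 ?ltW.
by rewrite ltrXn2r// ?nnegrE ?sqrtr_ge0 ?ltW.
Qed.

Lemma sqr_Tlow sigS (T0 : R) : 0 < sigS -> 0 <= qmax q ->
  Tlow q sigS T0 ^+ 2 = qmax q / (2 * sigS) + T0 ^+ 2.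
Proof.
move=> s0 q0; rewrite /Tlow sqr_sqrtr; first by field; rewrite gt_eqF.
by rewrite addr_ge0 ?sqr_ge0// mulr_ge0 ?invr_ge0// divr_ge0// ltW.
Qed.

Hypotheses (N_gt0 : (0 < N)%N) (L0 : forall i, \sum_j L i j = 0).
Hypothesis phi_bnd :
  forall i, exists B : R, forall t, 0 <= t -> enorm (phi i t) <= B.
Hypotheses (kt_ge0 : 0 <= kt) (q_gt0 : forall i, 0 < q i 0).
Variables (sigS omega T0 T : R) (chi : R -> R).
Hypotheses (sigS_gt0 : 0 < sigS)
  (Sigma_ge : loewner_le sigS%:M (bSigma phi trec L kr kc q)).
Hypothesis chi_bnd : chi_bound phi L kc q chi.
Hypotheses (omega_lt1 : omega < 1) (T0_gt0 : 0 < T0) (T0T : T0 < T).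
Hypothesis Tlow_lt : Tlow q sigS T0 < T.
Hypothesis Tup_gt : (T%:E < Tup n L kc q sigS chi kt omega)%E.

Local Notation V := (lyap (bQ n q) (bSigma phi trec L kr kc q)).

Let qmax_gt0 : 0 < qmax q.
Proof. exact: lt_le_trans (q_gt0 (Ordinal N_gt0)) (qmax_ge _ _). Qed.

Lemma bSigma_sym : (bSigma phi trec L kr kc q)^T = bSigma phi trec L kr kc q.
Proof.
case: Sigma_ge => + _; rewrite linearB/= tr_scalar_mx.
by move=> /(congr1 (+%R^~ sigS%:M)); rewrite !subrK.
Qed.

Let Qge v : qmin q * dot v v <= dot v (bQ n q *m v).
Proof. by apply: dot_kronI_diag_lower => i; rewrite mxE qmin_le. Qed.

Let Qle v : dot v (bQ n q *m v) <= qmax q * dot v v.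
Proof. by apply: dot_kronI_diag_le => i; rewrite mxE qmax_ge. Qed.

Let Sge v : sigS * dot v v <= dot v (bSigma phi trec L kr kc q *m v).
Proof. by rewrite -dot_scalar; exact: loewner_le_dot. Qed.

Lemma Hc_lyap_ge0 x z tau : 0 <= V x z tau.
Proof. exact: (lyap_ge0 (qmin_gt0 N_gt0 q_gt0) sigS_gt0 Qge Sge). Qed.

Lemma Hc_lyap_bounds : exists c1 c2, [/\ 0 < c1, 0 < c2 &
  forall x z tau, T0 <= tau -> tau <= T ->
    c1 * (dot x x + dot z z) <= V x z tau /\
    V x z tau <= c2 * (dot x x + dot z z)].
Proof.
have [S1 S10 Sle] := dot_mulmx_diag_le (bSigma phi trec L kr kc q).
have [c1 c10 H1] := lyap_lower (qmin_gt0 N_gt0 q_gt0) sigS_gt0 T0_gt0 Qge Sge.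
have [c2 c20 H2] := lyap_upper (qmin_gt0 N_gt0 q_gt0) qmax_gt0 sigS_gt0 S10
  T0_gt0 T0T bQ_sym Qge Qle Sge Sle.
exists c1, c2; split => // x z tau Ttau tauT; split; first exact: H1.
by have [] := H2 x z tau Ttau tauT.
Qed.

Lemma Hc_lyap_flow : exists lam K, [/\ 0 < lam, 0 < K &
  forall theta p tau s r u, T0 <= tau -> tau <= T -> 0 <= s -> r <= omega ->
    lyap_der (bQ n q) (bSigma phi trec L kr kc q)
      (theta - consensus N thetastar) (p - consensus N thetastar) tau
      ((2 / tau) *: (p - theta))
      (- (2 * tau) *: (kt *: bPsi phi thetastar theta s u
        + kr *: bPhi phi trec thetastar theta u + kc *: (kronI n L *m theta))) r
    <= - lam * V (theta - consensus N thetastar) (p - consensus N thetastar) tau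
       + K * enorm u ^+ 2].
Proof.
have [S1 S10 Sle] := dot_mulmx_diag_le (bSigma phi trec L kr kc q).
have [C C0 HC] := input_drive_le phi_bnd.
have qmin0 := qmin_gt0 N_gt0 q_gt0.
have [lam [K [lam0 K0 H]]] := lyap_decrease qmin0 qmax_gt0 sigS_gt0 S10
  T0_gt0 T0T bQ_sym bSigma_sym Qge Qle Sge Sle omega_lt1
  (addr_ge0 (sqr_ge0 _) (sqr_ge0 _))
  (Tup_sqr_lt sigS_gt0 omega_lt1 (lt_trans T0_gt0 T0T) qmin0 Tup_gt).
exists lam, (K * C); split; rewrite ?mulr_gt0// => theta p tau s r u h1 h2 s0 h3.
set x := theta - _; set z := p - _.
have -> : p - theta = z - x by rewrite /x /z opprB addrA subrK.
apply: le_trans (H (flow_skew s) _ _ x z tau r _ _ h1 h2 h3 (bQ_flow _ _ _ L0)) _.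
- by move=> v; exact: flow_skew_tr_le.
- by move=> v; apply: flow_skew_ge0 => // i; exact: ltW.
by rewrite lerD2l -mulrA ler_pM2l// HC.
Qed.

Let sqr_Tlow_lt : qmax q / (2 * sigS) + T0 ^+ 2 < T ^+ 2.
Proof.
have T_gt0 := lt_trans T0_gt0 T0T.
by rewrite -sqr_Tlow ?ltW// ltrXn2r// ?nnegrE ?sqrtr_ge0 ?ltW.
Qed.

Lemma Hc_lyap_jump eta x z :
  V x (z + restart_mx R n eta *m (x - z)) T0 <= V x z T.
Proof.
pose d : 'rV[R]_N := \row_i (q i 0 * (eta i)%:R).
(* Both factors are diagonal, so the product has entries q_i eta_i, between 0 and qmax; the
   projection identity comes from eta_i^2 = eta_i. *)
have QP : bQ n q *m restart_mx R n eta = kronI n (diag_mx d).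
  rewrite kronI_diagM; congr (kronI n (diag_mx _)).
  by apply/rowP => i; rewrite !mxE.
apply: (lyap_jump qmax_gt0 sigS_gt0 bQ_sym Sge).
- by rewrite QP kronI_diag_sym.
- rewrite QP kronI_diag_sym kronI_diagM; congr (kronI n (diag_mx _)).
  apply/rowP => i; rewrite !mxE mulrCA -natrM.
  by case: (eta i).
- move=> v; rewrite QP; apply: dot_kronI_diag_ge0 => i.
  by rewrite mxE mulr_ge0 ?ler0n// ltW.
- move=> v; rewrite QP; apply: dot_kronI_diag_le => i.
  rewrite mxE; case: (eta i); rewrite ?mulr1 ?mulr0 ?qmax_ge//.
  exact: ltW.
- exact: ltW.
Qed.

Lemma Hc_lyap_restart x z :
  V x (z + restart_mx R n (fun=> true) *m (x - z)) T0 <=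
  (Tlow q sigS T0 / T) ^+ 2 * V x z T.
Proof.
have -> : restart_mx R n (fun=> true) *m (x - z) = x - z.
  by apply: block_inj => i; rewrite block_kronI_diag mxE scale1r.
rewrite subrKC expr_div_n sqr_Tlow ?(ltW qmax_gt0)//.
exact: (lyap_restart (qmin_gt0 N_gt0 q_gt0) qmax_gt0 sigS_gt0 T0_gt0 T0T).
Qed.

End Network.

(** * Differentiation and integration along trajectories *)

Section TrajectoryCalculus.
Variable R : realType.
Local Notation mu := (@lebesgue_measure R).
Implicit Types (a b t : R) (f g : R -> R).

(** Coordinatewise, so that extracting state components and forming quadratic expressions reduces to
    real derivatives. *)
Definition cderive m (f : R -> 'cV[R]_m) t (v : 'cV[R]_m) : Prop :=
  forall i, is_derive t (1 : R) (fun s => f s i 0) (v i 0).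

Definition cac m a b (f : R -> 'cV[R]_m) := forall i, ac a b (fun s => f s i 0).

Lemma is_derive_cderive m (f : R -> 'cV[R]_m) t v :
  is_derive t (1 : R) f v -> cderive f t v.
Proof.
move=> [df <-] i; apply: DeriveDef; first exact: (derivable_mxP _ _ _).1.
by rewrite derive_mx// mxE.
Qed.

Lemma absolutely_continuous_on_cac m a b (f : R -> 'cV[R]_m) :
  absolutely_continuous_on a b f -> cac a b f.
Proof.
move=> acf i e e0; have [d d0 H] := acf e e0.
exists d => // k l r [H1 H2] lr; apply: le_lt_trans (H k l r H1 H2 lr).
apply: ler_sum => j _; apply: le_trans (coord_le_enorm _ i).
by rewrite !mxE.
Qed.

Lemma cderive_usubmx m p (f : R -> 'cV[R]_(m + p)) t v :
  cderive f t v -> cderive (fun s => usubmx (f s)) t (usubmx v).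
Proof. by move=> H i; rewrite mxE; under eq_fun do rewrite mxE; exact: H. Qed.

Lemma cderive_dsubmx m p (f : R -> 'cV[R]_(m + p)) t v :
  cderive f t v -> cderive (fun s => dsubmx (f s)) t (dsubmx v).
Proof. by move=> H i; rewrite mxE; under eq_fun do rewrite mxE; exact: H. Qed.

Lemma cderiveB m (f g : R -> 'cV[R]_m) t v w :
  cderive f t v -> cderive g t w -> cderive (fun s => f s - g s) t (v - w).
Proof.
move=> H1 H2 i; rewrite !mxE; under eq_fun do rewrite !mxE.
exact: (is_deriveB (H1 i) (H2 i)).
Qed.

Lemma cderive_cst m (c : 'cV[R]_m) t : cderive (fun=> c) t 0.
Proof. by move=> i; rewrite mxE; exact: is_derive_cst. Qed.

Lemma is_derive_bigsum m (h : 'I_m -> R -> R) (dh : 'I_m -> R) t :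
  (forall i, is_derive t (1 : R) (h i) (dh i)) ->
  is_derive t (1 : R) (fun s => \sum_i h i s) (\sum_i dh i).
Proof.
move=> /is_derive_sum; congr (is_derive _ _ _ _).
by apply/funext => s; rewrite fct_sumE.
Qed.

Lemma is_derive_prod f g (df dg : R) t :
  is_derive t (1 : R) f df -> is_derive t (1 : R) g dg ->
  is_derive t (1 : R) (fun s => f s * g s) (df * g t + f t * dg).
Proof.
by move=> /is_deriveM /[apply] H; apply: is_derive_eq; rewrite addrC mulrC.
Qed.

Lemma cderive_mulmx m p (B : 'M[R]_(p, m)) (f : R -> 'cV[R]_m) t v :
  cderive f t v -> cderive (fun s => B *m f s) t (B *m v).
Proof.
move=> H i; rewrite mxE; under eq_fun do rewrite mxE.
apply: is_derive_bigsum => j.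
have := is_derive_prod (is_derive_cst (B i j) t (1 : R)) (H j).
by rewrite mul0r add0r.
Qed.

Lemma is_derive_dot m (f g : R -> 'cV[R]_m) t v w :
  cderive f t v -> cderive g t w ->
  is_derive t (1 : R) (fun s => dot (f s) (g s)) (dot v (g t) + dot (f t) w).
Proof.
move=> H1 H2; rewrite !dotE -big_split/=.
under eq_fun do rewrite dotE.
apply: is_derive_bigsum => i; exact: is_derive_prod.
Qed.

Lemma is_derive_lyap m (Q S : 'M[R]_m) (x z : R -> 'cV[R]_m) (tau : R -> R)
    t dx dz r : Q^T = Q -> S^T = S ->
  cderive x t dx -> cderive z t dz -> is_derive t (1 : R) tau r ->
  is_derive t (1 : R) (fun s => lyap Q S (x s) (z s) (tau s))
    (lyap_der Q S (x t) (z t) (tau t) dx dz r).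
Proof.
move=> QT ST Hx Hz Ht.
have Hzx := cderiveB Hz Hx.
have quad B (f : R -> 'cV[R]_m) v : B^T = B -> cderive f t v ->
    is_derive t (1 : R) (fun s => dot (f s) (B *m f s)) (2 * dot (f t) (B *m v)).
  move=> BT Hf; have := is_derive_dot Hf (cderive_mulmx B Hf).
  by rewrite (dot_sym v (f t) BT) -mulr2n mulr_natl.
have scal (c : R) f d : is_derive t (1 : R) f d ->
    is_derive t (1 : R) (fun s => c * f s) (c * d).
  move=> Hf; have := is_derive_prod (is_derive_cst c t (1 : R)) Hf.
  by rewrite mul0r add0r.
have t2 := is_derive_prod Ht Ht.
have H := is_deriveD (is_deriveD (scal 4^-1 _ _ (quad Q _ _ QT Hzx))
  (scal 4^-1 _ _ (quad Q _ _ QT Hz)))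
  (is_derive_prod (scal 2^-1 _ _ t2) (quad S _ _ ST Hx)).
rewrite (_ : (fun s => _) = (fun s => 4^-1 * dot (z s - x s) (Q *m (z s - x s))
  + 4^-1 * dot (z s) (Q *m z s) + 2^-1 * (tau s * tau s) * dot (x s) (S *m x s))).
  by apply: is_derive_eq; rewrite /lyap_der; field.
by apply/funext => s; rewrite /lyap; field.
Qed.

Lemma cac_usubmx m p a b (f : R -> 'cV[R]_(m + p)) :
  cac a b f -> cac a b (fun s => usubmx (f s)).
Proof. by move=> H i; under eq_fun do rewrite mxE; exact: H. Qed.

Lemma cac_dsubmx m p a b (f : R -> 'cV[R]_(m + p)) :
  cac a b f -> cac a b (fun s => dsubmx (f s)).
Proof. by move=> H i; under eq_fun do rewrite mxE; exact: H. Qed.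

Lemma cacB m a b (f g : R -> 'cV[R]_m) : a <= b ->
  cac a b f -> cac a b g -> cac a b (fun s => f s - g s).
Proof.
move=> ab H1 H2 i; under eq_fun do rewrite !mxE -mulN1r.
exact: (acD (H1 i) (acZ (-1) ab (H2 i))).
Qed.

Lemma cac_cst m a b (c : 'cV[R]_m) : cac a b (fun=> c).
Proof. by move=> i; exact: ac_cst. Qed.

Lemma cac_mulmx m p a b (B : 'M[R]_(p, m)) (f : R -> 'cV[R]_m) : a <= b ->
  cac a b f -> cac a b (fun s => B *m f s).
Proof.
move=> ab H i.
rewrite (_ : (fun s => _) = fun s => \sum_j B i j * f s j 0); last first.
  by apply/funext => s; rewrite mxE.
by apply: (@ac_sum _ _ _ _ _ (fun j s => B i j * f s j 0)) => j; exact: acZ.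
Qed.

Lemma ac_dot m a b (f g : R -> 'cV[R]_m) : a <= b ->
  cac a b f -> cac a b g -> ac a b (fun s => dot (f s) (g s)).
Proof.
move=> ab H1 H2.
rewrite (_ : (fun s => _) = fun s => \sum_j f s j 0 * g s j 0); last first.
  by apply/funext => s; rewrite dotE.
by apply: (@ac_sum _ _ _ _ _ (fun j s => f s j 0 * g s j 0)) => j; exact: acM.
Qed.

Lemma ac_lyap m (Q S : 'M[R]_m) a b (x z : R -> 'cV[R]_m) (tau : R -> R) :
  a <= b -> cac a b x -> cac a b z -> ac a b tau ->
  ac a b (fun s => lyap Q S (x s) (z s) (tau s)).
Proof.
move=> ab Hx Hz Ht.
have quad B (f : R -> 'cV[R]_m) : cac a b f -> ac a b (fun s => dot (f s) (B *m f s)).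
  by move=> Hf; apply: ac_dot => //; exact: cac_mulmx.
apply: acD; first by apply: acD; apply: acZ => //; apply: quad => //; exact: cacB.
apply: acM => //; last exact: quad.
apply: acM => //; last exact: ac_cst.
exact: (acM ab Ht Ht).
Qed.

Lemma ae_imply (P P' : R -> Prop) : (forall t, P t -> P' t) ->
  (\forall t \ae mu, P t) -> \forall t \ae mu, P' t.
Proof.
move=> PP' [A [mA A0 PA]]; exists A; split => // t nP't.
by apply: PA => /PP'.
Qed.

Lemma ae_imply2 (P P1 P' : R -> Prop) : (forall t, P t -> P1 t -> P' t) ->
  (\forall t \ae mu, P t) -> (\forall t \ae mu, P1 t) -> \forall t \ae mu, P' t.
Proof.
move=> PP' hP hP1; have := negligibleU hP hP1.
move=> [A [mA A0 PA]]; exists A; split => // t nP't.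
apply: PA; have [Pt|nPt] := pselect (P t); last by left.
by right => P1t; apply: nP't; exact: PP'.
Qed.

(** The integrating factor expR (lam t) makes expR (lam t) (f t - c) nonincreasing. No sign of f - c
    is assumed, so the estimate also holds when V is already below the level [c] set by the
    input. *)
Lemma ac_decay a b f (lam c : R) : a <= b -> ac a b f ->
  (\forall t \ae mu, a < t -> t < b ->
     exists2 d, d <= - lam * (f t - c) & is_derive t 1 f d) ->
  f b - c <= expR (- lam * (b - a)) * (f a - c).
Proof.
move=> ab acf fder.
pose W t := expR (lam * t) * (f t - c).
have acW : ac a b W.
  by apply: acM => //; [exact: ac_expR|exact: (acD acf (ac_cst _ _ _))].
have : W b <= W a.
  apply: ac_nonincreasing => //; apply: ae_imply fder => t H at_ tb.
  have [d dle Hd] := H at_ tb.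
  have He : is_derive t (1 : R) (fun s => expR (lam * s)) (expR (lam * t) * lam).
    have := is_derive1_comp (is_derive_expR (lam * t))
      (is_derive_prod (is_derive_cst lam t (1 : R)) (is_derive_id t (1 : R))).
    by rewrite mul0r add0r mulr1.
  have Hc := is_deriveB Hd (is_derive_cst c t (1 : R)).
  have HW := is_derive_prod He Hc.
  eexists; last exact: HW.
  rewrite subr0 -mulrA -mulrDr pmulr_rle0 ?expR_gt0//.
  by rewrite (_ : (f - cst c) t = f t - c)//; lra.
rewrite /W -ler_pdivlMl ?expR_gt0// -expRN mulrA -expRD => H.
by apply: le_trans H _; rewrite (_ : - (lam * b) + lam * a = - lam * (b - a)) //; ring.
Qed.

Lemma ac_growth a b f (k : R) : a <= b -> ac a b f ->
  (\forall t \ae mu, a < t -> t < b -> exists2 d, d <= k & is_derive t 1 f d) ->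
  f b <= f a + k * (b - a).
Proof.
move=> ab acf fder.
pose W t := f t + - k * t.
have acW : ac a b W by apply: acD => //; apply: acZ => //; exact: ac_id.
suff : W b <= W a by rewrite /W; lra.
apply: ac_nonincreasing => //; apply: ae_imply fder => t H at_ tb.
have [d dle Hd] := H at_ tb.
have HW := is_deriveD Hd
  (is_derive_prod (is_derive_cst (- k) t (1 : R)) (is_derive_id t (1 : R))).
eexists; last exact: HW.
by rewrite /cst; lra.
Qed.

End TrajectoryCalculus.

(** * Induction on hybrid time and the input norm *)

Section HybridInduction.
Variable R : realType.
Local Notation mu := (@lebesgue_measure R).

(** The switching times of the compact truncation at (t, j), whose last interval is cut at t. *)
Lemma htd_slices (E : set (R * nat)) t j : hybrid_time_domain E -> E (t, j) ->
  exists tt : nat -> R, [/\ tt 0%N = 0, tt j.+1 = t,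
    forall k, (k <= j)%N -> tt k <= tt k.+1 /\ tt k.+1 <= t &
    forall k s, (k <= j)%N -> s <= t -> (E (s, k) <-> tt k <= s <= tt k.+1)].
Proof.
move=> [_ H] Etj; have [J [tt [tt0 tt1 /seteqP[sub1 sub2]]]] := H t j Etj.
have [jJ /andP[tjt ttj]] : (j < J)%N /\ tt j <= t <= tt j.+1.
  by apply: (sub1 (t, j)); split => //; split.
have ttk k : (k <= j)%N -> tt k <= tt k.+1 /\ tt k.+1 <= t.
  move=> kj; have kJ : (k < J)%N by exact: leq_ltn_trans jJ.
  have ttk := tt1 k kJ; split => //.
  have [_ []//] : (E `&` [set z | z.1 <= t /\ (z.2 <= j)%N]) (tt k.+1, k).
  by apply: sub2; split => //=; rewrite ttk lexx.
exists tt; split => //.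
  by apply/le_anti; rewrite ttj (ttk j _).2.
move=> k s kj st; have kJ : (k < J)%N by exact: leq_ltn_trans jJ.
split => [Esk|ks]; first by have [] := sub1 (s, k) (conj Esk (conj st kj)).
by have [] := sub2 (s, k) (conj kJ ks).
Qed.

(** The side conditions [k <= j] and [b <= t] keep every step below the final point, so a bound on
    the input up to (t, j) can be used throughout. *)
Lemma htd_ind (E : set (R * nat)) t j (P : R -> nat -> Prop) :
  hybrid_time_domain E -> E (t, j) -> P 0 0%N ->
  (forall k a b, (k <= j)%N -> a <= b -> b <= t ->
     `[a, b] `<=` htd_slice E k -> P a k -> P b k) ->
  (forall k s, (k < j)%N -> s <= t -> E (s, k) -> E (s, k.+1) ->
     P s k -> P s k.+1) ->
  P t j.
Proof.
move=> hE Etj P0 Pflow Pjump.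
have [tt [tt0 ttj ttk HE]] := htd_slices hE Etj.
have flow k : (k <= j)%N -> P (tt k) k -> P (tt k.+1) k.
  move=> kj; have [h1 h2] := ttk k kj; apply: Pflow => // s /=.
  rewrite in_itv/= => /andP[h3 h4]; apply/HE => //; last by rewrite h3.
  exact: le_trans h2.
have H k : (k <= j)%N -> P (tt k) k.
  elim: k => [_|k IH kj]; first by rewrite tt0.
  have kj' := ltnW kj; have [h1 h2] := ttk k kj'.
  apply: Pjump => //; last by apply: flow => //; exact: IH.
    by apply/HE => //; rewrite h1 lexx.
  by apply/HE => //; rewrite lexx (ttk k.+1 kj).1.
by rewrite -ttj; apply: flow => //; exact: H.
Qed.

(** Below (t, j) there are finitely many compact slices, and [u] is essentially bounded on each. The
    maximum is therefore finite and [fine] loses nothing. *)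
Lemma input_norm_ge p (E : set (R * nat)) (u : R -> nat -> 'cV[R]_p) t j :
  hybrid_input E u -> E (t, j) -> forall k, (k <= j)%N ->
  \forall s \ae mu, E (s, k) -> s <= t -> enorm (u s k) <= input_norm E u t j.
Proof.
move=> [hE _ bu] Etj.
pose F k s := if `[< E (s, k) /\ s <= t >] then (enorm (u s k))%:E else 0%E.
have [tt [tt0 ttj ttk HE]] := htd_slices hE Etj.
have Foo k : (k <= j)%N -> (ess_sup mu (F k) < +oo)%E.
  move=> kj; have [h1 h2] := ttk k kj.
  have [|M HM] := bu k _ _ h1.
    move=> s /=; rewrite in_itv/= => /andP[h3 h4]; apply/HE => //.
      exact: le_trans h2.
    by rewrite h3.
  (* Off the slice [F] is 0, while [M] may be negative when the slice is null. *)
  apply: (@le_lt_trans _ _ (Num.max M 0)%:E); last exact: ltry.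
  apply/ess_supP; apply: ae_imply HM => s HM; rewrite /F; case: asboolP => [[Es st]|_].
    by rewrite lee_fin le_max HM// in_itv/=; apply/HE.
  by rewrite lee_fin le_max lexx orbT.
set X := (\big[maxe/0%E]_(k < j.+1) ess_sup mu (F k))%E.
have X0 : (0 <= X)%E by exact: bigmax_ge_id.
have Xoo : (X < +oo)%E.
  by apply: bigmax_lt => // k _; apply: Foo; rewrite -ltnS.
have XE : X = (input_norm E u t j)%:E.
  by rewrite /input_norm fineK// ge0_fin_numE.
move=> k kj; apply: ae_imply (ess_sup_ge mu (F k)) => s Fs Es st.
rewrite -lee_fin -XE; apply: (@le_trans _ _ (ess_sup mu (F k))).
  by move: Fs; rewrite /F asboolT.
rewrite -ltnS in kj.
exact: (le_bigmax _ (fun i : 'I_j.+1 => ess_sup mu (F i)) (Ordinal kj)).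
Qed.

Lemma input_norm_ge0 p (E : set (R * nat)) (u : R -> nat -> 'cV[R]_p) t j :
  0 <= input_norm E u t j.
Proof. by rewrite fine_ge0//; exact: bigmax_ge_id. Qed.

End HybridInduction.

(** * Distance to the attractor *)

Section Distance.
Variables (R : realType) (N n : nat) (thetastar : 'cV[R]_n) (T0 T : R).
Implicit Types y : 'cV[R]_(state_dim N n).

(** The squared distance to [Ac] when tau and s are admissible: [setdist_Ac_le] takes the point of
    [Ac] with the same tau and s, and [sqrt_sqr_err_le] drops their contribution. *)
Definition sqr_err y : R :=
  dot (st_theta y - consensus N thetastar) (st_theta y - consensus N thetastar)
  + dot (st_p y - consensus N thetastar) (st_p y - consensus N thetastar).

Lemma sqr_err_ge0 y : 0 <= sqr_err y.
Proof. by rewrite addr_ge0 ?dot_ge0. Qed.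

Lemma dot_submx m p (x y : 'cV[R]_(m + p)) :
  dot x y = dot (usubmx x) (usubmx y) + dot (dsubmx x) (dsubmx y).
Proof.
rewrite !dotE big_split_ord/=.
by congr (_ + _); apply: eq_bigr => i _; rewrite !mxE.
Qed.

Lemma dot_state y y' : dot (y - y') (y - y') =
  dot (st_theta y - st_theta y') (st_theta y - st_theta y')
  + (dot (st_p y - st_p y') (st_p y - st_p y')
  + ((st_tau y - st_tau y') ^+ 2 + (st_s y - st_s y') ^+ 2)).
Proof.
rewrite /st_theta /st_p /st_tau /st_s.
rewrite dot_submx !linearB/=; congr (_ + _).
rewrite dot_submx !linearB/=; congr (_ + _).
rewrite dot_submx !linearB/= !dotE !big_ord1.
by rewrite !expr2; congr (_ + _); rewrite !mxE.
Qed.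

Lemma mkstateK (theta p : 'cV[R]_(N * n)) tau s :
  [/\ st_theta (mkstate theta p tau s) = theta,
      st_p (mkstate theta p tau s) = p,
      st_tau (mkstate theta p tau s) = tau
    & st_s (mkstate theta p tau s) = s].
Proof.
rewrite /st_theta /st_p /st_tau /st_s /mkstate !(col_mxKu, col_mxKd).
by rewrite !mxE !mulr1n.
Qed.

Lemma setdist_Ac_le y : T0 <= st_tau y -> st_tau y <= T -> 0 <= st_s y ->
  setdist (Ac thetastar T0 T) y <= Num.sqrt (sqr_err y).
Proof.
move=> h1 h2 h3.
pose a := mkstate (consensus N thetastar) (consensus N thetastar) (st_tau y) (st_s y).
have [a1 a2 a3 a4] : [/\ st_theta a = consensus N thetastar,
    st_p a = consensus N thetastar, st_tau a = st_tau y & st_s a = st_s y].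
  exact: mkstateK.
have -> : Num.sqrt (sqr_err y) = enorm (y - a).
  rewrite enorm_sqrE dot_state a1 a2 a3 a4 !subrr expr0n/= !addr0.
  by [].
apply: ge_inf; first by exists 0 => _ [b _ <-]; exact: enorm_ge0.
by exists a => //; split; rewrite ?a1 ?a2 ?a3 ?a4 ?h1 ?h2.
Qed.

Lemma sqrt_sqr_err_le y : T0 <= T ->
  Num.sqrt (sqr_err y) <= setdist (Ac thetastar T0 T) y.
Proof.
move=> T0T; apply: lb_le_inf.
  (* A point of [Ac]: a lower bound passes to the infimum only over a nonempty set. *)
  pose a := mkstate (consensus N thetastar) (consensus N thetastar) T0 0.
  have [a1 a2 a3 a4] : [/\ st_theta a = consensus N thetastar,
      st_p a = consensus N thetastar, st_tau a = T0 & st_s a = 0].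
    exact: mkstateK.
  by exists (enorm (y - a)), a => //; split; rewrite ?a1 ?a2 ?a3 ?a4 ?lexx.
move=> _ [a [a1 a2 _ _] <-]; rewrite enorm_sqrE ler_wsqrtr//.
by rewrite dot_state a1 a2 /sqr_err addrA lerDl addr_ge0 ?sqr_ge0.
Qed.

Lemma setdist_Ac_ge0 y : T0 <= T -> 0 <= setdist (Ac thetastar T0 T) y.
Proof. by move=> /(sqrt_sqr_err_le y); exact: le_trans (sqrtr_ge0 _). Qed.

Lemma sqr_err_le y : T0 <= T -> sqr_err y <= setdist (Ac thetastar T0 T) y ^+ 2.
Proof.
move=> T0T; rewrite -[leLHS]sqr_sqrtr ?sqr_err_ge0//.
by rewrite lerXn2r// ?nnegrE ?sqrtr_ge0 ?setdist_Ac_ge0 ?sqrt_sqr_err_le.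
Qed.

End Distance.

(** * The Lyapunov bound along solutions *)

Section Solutions.
Variables (R : realType) (N n : nat) (phi : 'I_N -> R -> 'cV[R]_n).
Variables (kbar : 'I_N -> nat) (trec : forall i, 'I_(kbar i) -> R).
Variables (L : 'M[R]_N) (kr kc kt : R) (q : 'cV[R]_N) (thetastar : 'cV[R]_n).
Variables (omega T0 T lam K : R) (eta : 'I_N -> bool) (rates : set R).
Local Notation mu := (@lebesgue_measure R).
Local Notation Q := (bQ n q).
Local Notation S := (bSigma phi trec L kr kc q).
Local Notation cons := (consensus N thetastar).
Local Notation H := (Hc phi trec L kr kc thetastar kt T0 T eta rates).

Hypotheses (S_sym : S^T = S) (lam_gt0 : 0 < lam) (K_ge0 : 0 <= K).
Hypotheses (T0T : T0 <= T) (rates_le : forall r, rates r -> r <= omega).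
Hypothesis flow_le :
  forall theta p tau s r u, T0 <= tau -> tau <= T -> 0 <= s -> r <= omega ->
    lyap_der Q S (theta - cons) (p - cons) tau
      ((2 / tau) *: (p - theta))
      (- (2 * tau) *: (kt *: bPsi phi thetastar theta s u
        + kr *: bPhi phi trec thetastar theta u + kc *: (kronI n L *m theta))) r
    <= - lam * lyap Q S (theta - cons) (p - cons) tau + K * enorm u ^+ 2.

Definition state_lyap (y : 'cV[R]_(state_dim N n)) : R :=
  lyap Q S (st_theta y - cons) (st_p y - cons) (st_tau y).

Variables (E : set (R * nat)) (y : R -> nat -> 'cV[R]_(state_dim N n)).
Variables (u : R -> nat -> 'cV[R]_(input_dim kbar)).
Hypothesis sol : solution_pair H E y u.

(** K / lam U^2 is the equilibrium of v' = - lam v + K U^2. The interval must be nondegenerate: the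
    flow set is only imposed in the interior of a slice, and its constraints reach [b] as limits
    from the left. *)
Lemma flow_segment k a b (U : R) : a < b -> `[a, b] `<=` htd_slice E k ->
  (\forall s \ae mu, a < s -> s < b -> enorm (u s k) <= U) ->
  [/\ T0 <= st_tau (y b k), st_tau (y b k) <= T, 0 <= st_s (y b k),
      st_tau (y b k) <= st_tau (y a k) + omega * (b - a) &
      state_lyap (y b k) - K / lam * U ^+ 2 <=
      expR (- lam * (b - a)) * (state_lyap (y a k) - K / lam * U ^+ 2)].
Proof.
move=> ab abE uU; have lab := ltW ab.
have acy : cac a b (y ^~ k).
  by apply: absolutely_continuous_on_cac; exact: (sol_arc sol).2.
have ac1 := cac_usubmx acy.
have ac2 := cac_usubmx (cac_dsubmx acy).
have act := cac_usubmx (cac_dsubmx (cac_dsubmx acy)) 0.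
have acs := cac_dsubmx (cac_dsubmx (cac_dsubmx acy)) 0.
have int s : a < s -> s < b -> (htd_slice E k)° s.
  move=> as_ sb; rewrite /interior; apply: (@filterS _ _ _ `]a, b[).
    by move=> r rab; apply: abE; exact: subset_itv_oo_cc.
  by apply: near_in_itvoo; rewrite in_itv/= as_ sb.
have fs s : a < s -> s < b ->
    [/\ T0 <= st_tau (y s k), st_tau (y s k) <= T & 0 <= st_s (y s k)].
  by move=> as_ sb; have [/andP[]] := sol_flow_set sol (int s as_ sb).
have der : \forall s \ae mu, a < s -> s < b -> exists r, [/\ rates r,
    cderive (fun s => st_theta (y s k)) s
      ((2 / st_tau (y s k)) *: (st_p (y s k) - st_theta (y s k))),
    cderive (fun s => st_p (y s k)) s
      (- (2 * st_tau (y s k)) *: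
        (kt *: bPsi phi thetastar (st_theta (y s k)) (st_s (y s k)) (u s k)
         + kr *: bPhi phi trec thetastar (st_theta (y s k)) (u s k)
         + kc *: (kronI n L *m st_theta (y s k)))) &
    is_derive s (1 : R) (fun s => st_tau (y s k)) r].
  apply: ae_imply (sol_flow sol k) => s Hs as_ sb.
  have [v [r rr <-] /is_derive_cderive dv] := Hs (int s as_ sb).
  exists r; set v1 := _ *: _ in dv; set v2 := _ *: _ in dv.
  have [e1 e2 e3 e4] := mkstateK v1 v2 r 1; split => //.
  - by rewrite -[X in cderive _ _ X]e1; exact: cderive_usubmx.
  - by rewrite -[X in cderive _ _ X]e2; exact: cderive_usubmx (cderive_dsubmx dv).
  - rewrite -e3; exact: (cderive_usubmx (cderive_dsubmx (cderive_dsubmx dv)) 0).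
split.
- rewrite -lerN2; apply: (ac_le_right ab (f := fun s => - st_tau (y s k))).
    exact: acN.
  by move=> s as_ sb; rewrite lerN2; have [] := fs s as_ sb.
- by apply: (ac_le_right ab act) => s as_ sb; have [] := fs s as_ sb.
- rewrite -oppr_le0; apply: (ac_le_right ab (f := fun s => - st_s (y s k))).
    exact: acN.
  by move=> s as_ sb; rewrite oppr_le0; have [] := fs s as_ sb.
- apply: (ac_growth lab act); apply: ae_imply der => s Hs as_ sb.
  have [r [rr _ _ dr]] := Hs as_ sb; exists r => //; exact: rates_le.
- apply: (ac_decay (f := fun s => state_lyap (y s k)) lab).
    by apply: ac_lyap => //; apply: cacB => //; exact: cac_cst.
  apply: ae_imply2 der uU => s Hs us as_ sb.
  have [r [rr d1 d2 dr]] := Hs as_ sb; have [h1 h2 h3] := fs s as_ sb.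
  have d1' := cderiveB d1 (cderive_cst cons s).
  have d2' := cderiveB d2 (cderive_cst cons s).
  rewrite subr0 in d1'; rewrite subr0 in d2'.
  eexists; last exact: (is_derive_lyap (bQ_sym _ _) S_sym d1' d2' dr).
  apply: le_trans (flow_le _ _ _ h1 h2 h3 (rates_le rr)) _.
  have us2 : enorm (u s k) ^+ 2 <= U ^+ 2.
    have := us as_ sb => us'.
    by rewrite lerXn2r// ?nnegrE ?enorm_ge0//; exact: le_trans (enorm_ge0 _) us'.
  have := ler_wpM2l K_ge0 us2; rewrite -/(state_lyap (y s k)).
  rewrite [X in _ -> _ <= X](_ : _ = - lam * state_lyap (y s k) + K * U ^+ 2).
    by lra.
  by field; rewrite gt_eqF.
Qed.

(* For (a), rho = 1 and B t k = exp (- lam t); for (b), rho = mu and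
   B t k = mu ^ k. *)
Variables (rho : R) (B : R -> nat -> R).
Hypothesis lyap_pos : forall x z tau, 0 <= lyap Q S x z tau.
Hypothesis jump_le : forall x z,
  lyap Q S x (z + restart_mx R n eta *m (x - z)) T0 <= rho * lyap Q S x z T.
Hypotheses (rho_ge0 : 0 <= rho) (rho_le1 : rho <= 1) (B0 : B 0 0%N = 1).
Hypothesis B_flow : forall a b k, a <= b ->
  expR (- lam * (b - a)) * B a k <= B b k.
Hypothesis B_jump : forall t k, rho * B t k <= B t k.+1.

(* The bound on tau + j (T - T0) is the dwell-time condition: it bounds the
   number of jumps by an affine function of t, hence turns decay in t into
   decay in t + j. *)
Lemma solution_bound t j : E (t, j) ->
  [/\ T0 <= st_tau (y t j), st_tau (y t j) <= T, 0 <= st_s (y t j),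
      st_tau (y t j) + j%:R * (T - T0) <= T + omega * t &
      state_lyap (y t j) <=
      B t j * state_lyap (y 0 0%N) + K / lam * input_norm E u t j ^+ 2].
Proof.
move=> Etj; set U := input_norm E u t j.
have cU0 : 0 <= K / lam * U ^+ 2 by rewrite mulr_ge0 ?sqr_ge0// divr_ge0// ltW.
(* [U] is fixed at the final point, so the level subtracted from V stays constant through the
   induction; the jump step uses rho <= 1 to keep it. *)
pose P s k := [/\ T0 <= st_tau (y s k), st_tau (y s k) <= T, 0 <= st_s (y s k),
  st_tau (y s k) + k%:R * (T - T0) <= T + omega * s &
  state_lyap (y s k) - K / lam * U ^+ 2 <= B s k * state_lyap (y 0 0%N)].
suff : P t j by move=> [h1 h2 h3 h4 h5]; split => //; rewrite -lerBlDr.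
apply: (htd_ind (sol_arc sol).1 Etj).
- have [h1 h2 h3] : [/\ T0 <= st_tau (y 0 0%N), st_tau (y 0 0%N) <= T
      & 0 <= st_s (y 0 0%N)].
    have [[/andP[]]|[->]] := sol_init sol; first by [].
    by rewrite lexx.
  split => //; first by rewrite mul0r mulr0 !addr0.
  by rewrite B0 mul1r lerBlDr lerDl.
- move=> k a b kj ab bt abE [h1 h2 h3 h4 h5].
  (* Slices may be single points when several jumps share a time. *)
  have [->|ab'] := eqVneq b a; first by split.
  have {}ab' : a < b by rewrite lt_neqAle eq_sym ab'.
  have uU : \forall s \ae mu, a < s -> s < b -> enorm (u s k) <= U.
    apply: ae_imply (input_norm_ge (sol_input sol) Etj kj) => s Hs as_ sb.
    apply: Hs; last by apply: le_trans bt; exact: ltW.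
    by apply: abE; rewrite /= in_itv/= !ltW.
  have [g1 g2 g3 g4 g5] := flow_segment ab' abE uU; split => //; first by lra.
  apply: le_trans g5 _; apply: le_trans (ler_wpM2l (expR_ge0 _) h5) _.
  by rewrite mulrA ler_wpM2r ?lyap_pos// B_flow.
- move=> k s kj st Esk Esk1 [h1 h2 h3 h4 h5].
  rewrite /P; have [[tauT _] ->] := sol_jump sol Esk Esk1.
  set v := mkstate _ _ _ _.
  have [e1 e2 e3 e4] : [/\ st_theta v = st_theta (y s k),
    st_p v = st_p (y s k) + restart_mx R n eta *m (st_theta (y s k) - st_p (y s k)),
    st_tau v = T0 & st_s v = st_s (y s k)] by exact: mkstateK.
  (* The jump counter is unchanged by the reset: T0 + (k + 1)(T - T0) = T + k (T - T0). *)
  rewrite /state_lyap e1 e2 e3 e4; split => //.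
    by rewrite -natr1; lra.
  have -> : st_p (y s k) + restart_mx R n eta *m (st_theta (y s k) - st_p (y s k))
      - cons = (st_p (y s k) - cons)
      + restart_mx R n eta *m ((st_theta (y s k) - cons) - (st_p (y s k) - cons)).
    by rewrite opprB addrA subrK addrAC.
  have j1 := jump_le (st_theta (y s k) - cons) (st_p (y s k) - cons).
  have j0 : lyap Q S (st_theta (y s k) - cons) (st_p (y s k) - cons) T
      = state_lyap (y s k).
    by rewrite /state_lyap tauT.
  rewrite j0 in j1.
  have j2 := ler_wpM2l rho_ge0 h5.
  have j3 : rho * (B s k * state_lyap (y 0 0%N)) <= B s k.+1 * state_lyap (y 0 0%N).
    by rewrite mulrA ler_wpM2r ?lyap_pos// B_jump.
  have j4 : rho * (K / lam * U ^+ 2) <= K / lam * U ^+ 2 by rewrite ler_piMl.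
  move: j1 j2 j3 j4; rewrite mulrBr -/(state_lyap (y 0 0%N)).
  lra.
Qed.

End Solutions.

(** * Comparison functions for the stability estimate *)

Section ComparisonFunctions.
Variable R : realType.

Lemma classK_linear (c : R) : 0 < c -> classK (fun r => c * r).
Proof.
move=> c0; split; last by rewrite mulr0.
  apply: continuous_subspaceT => r; exact: mulrl_continuous.
by move=> r s _ rs; rewrite ltr_pM2l.
Qed.

Lemma classKL_exp (C l : R) : 0 < C -> 0 < l ->
  classKL (fun r s => C * expR (- (l * s)) * r).
Proof.
move=> C0 l0.
have Ce s : 0 < C * expR (- (l * s)) by rewrite mulr_gt0 ?expR_gt0.
split.
- by move=> r s r0 _; rewrite mulr_ge0// ltW.
- by move=> r r' s _ rr' _; rewrite ler_pM2l.
- move=> r s s' r0 _ ss'; rewrite ler_wpM2r// ler_pM2l// ler_expR lerN2.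
  by rewrite ler_pM2l.
- move=> s _; rewrite -[X in _ --> X](mulr0 (C * expR (- (l * s)))).
  by apply: cvg_at_right_filter; exact: mulrl_continuous.
- move=> r _; rewrite -[X in _ --> X](mul0r r); apply: cvgMl.
  rewrite -[X in _ --> X](mulr0 C); apply: cvgMr.
  apply: (@cvg_comp _ _ _ (fun s => l * s) (fun x => expR (- x)) _ (pinfty_nbhs R));
    last exact: cvgr_expR.
  by apply: gt0_cvgMry => //; exact: cvg_id.
Qed.

Lemma sqrtr_le_add (x a b : R) : 0 <= a -> 0 <= b -> x <= a ^+ 2 + b ^+ 2 ->
  Num.sqrt x <= a + b.
Proof.
move=> a0 b0 xab; have ab0 := addr_ge0 a0 b0.
rewrite -(ger0_norm ab0) -sqrtr_sqr ler_wsqrtr//; apply: le_trans xab _.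
by rewrite sqrrD; have := mulr_ge0 a0 b0; lra.
Qed.

End ComparisonFunctions.

Theorem theorem1
  (R : realType) (N n : nat) (hN : (2 <= N)%N) (hn : (1 <= n)%N)
  (G : rel 'I_N) (hG : irreflexive G)
  (L : 'M[R]_N) (hL : weighted_laplacian G L)
  (thetastar : 'cV[R]_n)
  (phi : 'I_N -> R -> 'cV[R]_n)
  (hphi_cont : forall i, {within `[0, +oo[, continuous (phi i)})
  (hphi_bnd : forall i, exists M : R, forall t, 0 <= t -> enorm (phi i t) <= M)
  (kbar : 'I_N -> nat) (trec : forall i, 'I_(kbar i) -> R)
  (htrec : forall i (k : 'I_(kbar i)), 0 <= trec i k)
  (kr kc kt : R) (hkr : 0 < kr) (hkc : 0 < kc) (hkt : 0 <= kt)
  (hsc : strongly_connected G)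
  (hrich : cooperatively_sufficiently_rich phi trec)
  (q : 'cV[R]_N) (hq_unit : enorm q = 1) (hq_pos : forall i, 0 < q i 0)
  (hq_ker : q^T *m L = 0) (hq_psd : psd (Qmx q *m L + L^T *m Qmx q))
  (sigS : R) (hsigS : 0 < sigS)
  (hSigma : loewner_le sigS%:M (bSigma phi trec L kr kc q))
  (chi : R -> R) (hchi : classKoo chi) (hchi_bound : chi_bound phi L kc q chi)
  (omega T0 T : R) (homega0 : 0 < omega) (homega1 : omega < 1)
  (hT0 : 0 < T0) (hT0T : T0 < T)
  (hTlow : Tlow q sigS T0 < T)
  (hTup : (T%:E < Tup n L kc q sigS chi kt omega)%E) :
  (forall eta : 'I_N -> bool,
     ISS (Hc phi trec L kr kc thetastar kt T0 T eta [set r | 0 <= r <= omega])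
         (Ac thetastar T0 T))
  /\
  (exists k1 k2 : R, [/\ 0 < k1, 0 < k2 &
     let H := Hc phi trec L kr kc thetastar kt T0 T
                 (fun _ => true) [set omega] in
     forall y0, (flow_set H `|` jump_set H) y0 ->
     forall E y u, solution_pair H E y u -> y 0 0%N = y0 ->
     forall tj j, E (tj, j) -> (forall t, E (t, j) -> tj <= t) ->
       enorm (st_theta (y tj j) - consensus N thetastar) ^+ 2 <=
         k1 * ((Tlow q sigS T0 / T) ^+ 2) ^+ j
            * setdist (Ac thetastar T0 T) y0 ^+ 2
         + k2 * input_norm E u tj j ^+ 2]).
Proof.
have N0 : (0 < N)%N by exact: ltnW.
have L0 : forall i, \sum_j L i j = 0 by case: hL.
have [c1 [c2 [c10 c20 Vbnd]]] := Hc_lyap_bounds N0 hq_pos hsigS hSigma hT0 hT0T.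
have [lam [K [lam0 K0 Vflow]]] := Hc_lyap_flow thetastar N0 L0 hphi_bnd hkt
  hq_pos hsigS hSigma hchi_bound homega1 hT0 hT0T hTup.
have S_sym := bSigma_sym hSigma.
have V_ge0 := Hc_lyap_ge0 N0 hq_pos hsigS hSigma.
have T_gt0 : 0 < T := lt_trans hT0 hT0T.
have K1 : 0 < K / lam / c1 by rewrite !divr_gt0.
have expN (x : R) : 0 <= x -> expR (- lam * x) <= 1.
  by move=> x0; rewrite -expR0 ler_expR mulNr oppr_le0 mulr_ge0// ltW.
have err_le y : T0 <= st_tau y -> st_tau y <= T ->
    sqr_err thetastar y <= c1^-1 * state_lyap phi trec L kr kc q thetastar y.
  by move=> h1 h2; rewrite ler_pdivlMl//; have [] := Vbnd
    (st_theta y - consensus N thetastar) (st_p y - consensus N thetastar) _ h1 h2.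
have lyap_le y : T0 <= st_tau y -> st_tau y <= T ->
    state_lyap phi trec L kr kc q thetastar y <=
    c2 * setdist (Ac thetastar T0 T) y ^+ 2.
  move=> h1 h2; have [_] := Vbnd (st_theta y - consensus N thetastar)
    (st_p y - consensus N thetastar) _ h1 h2.
  move=> /le_trans; apply; rewrite ler_pM2l//.
  exact: sqr_err_le (ltW hT0T).
split.
  move=> eta.
  have TT0 : 0 < T - T0 by rewrite subr_gt0.
  (* The dwell-time bound gives j <= 1 + kap t, so t + j <= 1 + (1 + kap) t and expR (- lam t) <=
     expR (2 l) expR (- 2 l (t + j)). The 2 in [l] anticipates the square root that turns V into a
     distance. *)
  pose kap := omega / (T - T0); pose l := lam / (2 * (1 + kap)).
  have kap0 : 0 < kap by rewrite divr_gt0.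
  have l0 : 0 < l by rewrite divr_gt0// mulr_gt0// addr_gt0.
  (* The factor [expR l] pays for the additive 1 in the jump count. *)
  pose A := Num.sqrt (c2 / c1) * expR l; pose C := Num.sqrt (K / lam / c1).
  have A0 : 0 < A by rewrite mulr_gt0 ?expR_gt0// sqrtr_gt0 divr_gt0.
  have C0 : 0 < C by rewrite sqrtr_gt0.
  exists (fun r s => A * expR (- (l * s)) * r), (fun r => C * r); split.
  - exact: classKL_exp.
  - exact: classK_linear.
  move=> E y u [sol _] t j Etj.
  have bound := solution_bound S_sym lam0 (ltW K0) (ltW hT0T)
    (rates := [set r | 0 <= r <= omega]) (fun r h => (andP h).2) Vflow sol
    (rho := 1) (B := fun t _ => expR (- lam * t)) V_ge0.
  have b1 x z : lyap (bQ n q) (bSigma phi trec L kr kc q) x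
      (z + restart_mx R n eta *m (x - z)) T0 <=
      1 * lyap (bQ n q) (bSigma phi trec L kr kc q) x z T.
    by rewrite mul1r; exact: (Hc_lyap_jump N0 hq_pos hsigS).
  have b2 : expR (- lam * 0) = 1 by rewrite mulr0 expR0.
  have b3 (a b : R) (k : nat) : a <= b ->
      expR (- lam * (b - a)) * expR (- lam * a) <= expR (- lam * b).
    by move=> _; rewrite -expRD (_ : _ + _ = - lam * b)//; ring.
  have b4 (s : R) (k : nat) : 1 * expR (- lam * s) <= expR (- lam * s).
    by rewrite mul1r.
  have {b1 b2 b3 b4}bound := bound b1 ler01 (lexx 1) b2 b3 b4.
  have [h1 h2 h3 h4 h5] := bound t j Etj.
  have [g1 g2 _ _ _] := bound _ _ (sol_start sol).
  have t0 : 0 <= t by exact: ((sol_arc sol).1).1 _ Etj.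
  set d := setdist _ (y 0 0%N); set U := input_norm _ _ _ _.
  have d0 : 0 <= d by exact: setdist_Ac_ge0 (ltW hT0T).
  have U0 : 0 <= U by exact: input_norm_ge0.
  apply: le_trans (setdist_Ac_le _ h1 h2 h3) _; apply: sqrtr_le_add.
  - by rewrite !mulr_ge0 ?expR_ge0// ltW.
  - by rewrite mulr_ge0// ltW.
  apply: le_trans (err_le _ h1 h2) _.
  apply: le_trans (ler_wpM2l _ h5) _; first by rewrite invr_ge0 ltW.
  rewrite mulrDr -/U [X in _ <= _ + X]exprMn sqr_sqrtr ?(ltW K1)//.
  rewrite [X in _ + X <= _](_ : _ = K / lam / c1 * U ^+ 2); last by ring.
  rewrite lerD2r.
  have lyap0 := lyap_le _ g1 g2; rewrite -/d in lyap0.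
  have c1V : 0 <= c1^-1 by rewrite invr_ge0 ltW.
  apply: le_trans (ler_wpM2l c1V (ler_wpM2l (expR_ge0 _) lyap0)) _.
  rewrite /A -[X in (X * d) ^+ 2]mulrA -expRD !exprMn sqr_sqrtr; last first.
    by rewrite divr_ge0 ?ltW.
  rewrite [leLHS](_ : _ = c2 / c1 * expR (- lam * t) * d ^+ 2); last by ring.
  rewrite ler_wpM2r ?sqr_ge0// ler_pM2l ?divr_gt0// expr2 -expRD ler_expR.
  have lamE : lam = 2 * l * (1 + kap).
    by rewrite /l; field; rewrite gt_eqF// addr_gt0.
  have jk : j%:R <= 1 + kap * t.
    rewrite -(ler_pM2r TT0) mulrDl mul1r /kap.
    rewrite (_ : omega / (T - T0) * t * (T - T0) = omega * t); last first.
      by field; rewrite gt_eqF.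
    by lra.
  have := ler_wpM2l (ltW l0) jk; rewrite [in - lam * t]lamE; lra.
pose m := (Tlow q sigS T0 / T) ^+ 2.
have m0 : 0 <= m by exact: sqr_ge0.
have m1 : m <= 1.
  rewrite /m expr_le1// ?divr_ge0 ?sqrtr_ge0 ?(ltW T_gt0)//.
  by rewrite ler_pdivrMr// mul1r ltW.
exists (c2 / c1), (K / lam / c1); split => //; first by rewrite divr_gt0.
move=> H y0 _ E y u sol <- t j Etj _.
have b1 x z : lyap (bQ n q) (bSigma phi trec L kr kc q) x
    (z + restart_mx R n (fun=> true) *m (x - z)) T0 <=
    m * lyap (bQ n q) (bSigma phi trec L kr kc q) x z T.
  exact: (Hc_lyap_restart N0 hq_pos hsigS).
(* Flow decay is only used as an exponential factor at most 1; the powers of [m] come from the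
   restarts. *)
have b2 (a b : R) (k : nat) : a <= b ->
    expR (- lam * (b - a)) * m ^+ k <= m ^+ k.
  move=> ab; apply: ler_piMl; first exact: exprn_ge0.
  by apply: expN; rewrite subr_ge0.
have b3 (s : R) (k : nat) : m * m ^+ k <= m ^+ k.+1 by rewrite exprS.
have b4 r : [set omega] r -> r <= omega by move=> ->.
have bound := solution_bound S_sym lam0 (ltW K0) (ltW hT0T) b4 Vflow sol
  (B := fun _ k => m ^+ k) V_ge0 b1 m0 m1 (expr0 m) b2 b3.
have [h1 h2 h3 h4 h5] := bound t j Etj.
have [g1 g2 _ _ _] := bound _ _ (sol_start sol).
have c1V : 0 <= c1^-1 by rewrite invr_ge0 ltW.
rewrite sqr_enorm; apply: (@le_trans _ _ (sqr_err thetastar (y t j))).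
  by rewrite lerDl dot_ge0.
apply: le_trans (err_le _ h1 h2) _; apply: le_trans (ler_wpM2l c1V h5) _.
rewrite mulrDr [X in _ + X <= _](_ : _ = K / lam / c1 * input_norm E u t j ^+ 2);
  last by ring.
rewrite lerD2r -/m.
apply: le_trans (ler_wpM2l c1V (ler_wpM2l (exprn_ge0 _ m0) (lyap_le _ g1 g2))) _.
rewrite (_ : c1^-1 * _ = c2 / c1 * m ^+ j
  * setdist (Ac thetastar T0 T) (y 0 0%N) ^+ 2)//; ring.
Qed.
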